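(* In the coordinates $(y,\beta,r)$ on $D$: (i) $E(\mathcal{I}^2_1)=\left\{y^2=-\frac{|\beta|^2}{2}+\sqrt{1-r^2}\right\}$; (ii) $E(\mathcal{I}^2_2)=\left\{y^2=-\frac12|1-i\bar\beta|^2+\sqrt{\frac12-\left(\frac12-\mathrm{Re}(\beta)-r\right)^2}\right\}$; (iii) $D(\mathcal{I}^2_1)\subseteq E(\mathcal{I}^2_1)\cap\left\{\frac{1}{\sqrt5}<y^2\le1,\ -\frac12\le r\le\frac12,\ |\beta|^2<-\frac{2}{\sqrt5}+2\right\}$; (iv) $D(\mathcal{I}^2_2)\subseteq E(\mathcal{I}^2_2)\cap\left\{0\le\mathrm{Re}(\beta)+r<\sqrt{\frac{3}{10}}+\frac12\right\}$; (v) $D(\mathcal{I}^3_1)=D(\mathcal{I}^2_1)\cap\left\{r=\frac12\right\}$; (vi) $D(\mathcal{I}^3_2)=D(\mathcal{I}^2_1)\cap\left\{y^2=-\frac12|1+i-i\bar\beta|^2+\sqrt{1-(\mathrm{Re}(\beta(1+i))+r)^2}\right\}$; (vii) $D(\mathcal{I}^3_3)=D(\mathcal{I}^2_1)\cap\left\{y^2=-\frac12|1+i-i\bar\beta|^2+\sqrt{1-(1-r-\mathrm{Re}(\beta(1+i)))^2}\right\}$; (viii) $D(\mathcal{I}^4_1)=D(\mathcal{I}^2_1)\cap\left\{r=\frac12,\ \left|\beta-\frac{1+\sqrt3}{4}(1+\sqrt3\,i)\right|^2=\frac12\right\}$; (ix) $D(\mathcal{I}^4_2)=D(\mathcal{I}^2_1)\cap\left\{r=0,\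 \left|\beta-\frac{3+i}{2}\right|^2=\frac12\right\}$; (x) $D(\mathcal{I}^5)=\left\{\left(\frac{\sqrt{-1+2\sqrt3}}{2},\frac{1+i}{2},\frac12\right)\right\}$; (xi) $D(\mathcal{I}^8)=\left\{\left(\frac{1}{\sqrt2},i,0\right)\right\}$.
   Context: Let $H=\begin{pmatrix}0&0&i\\0&-1&0\\-i&0&0\end{pmatrix}$, $G=\mathrm{SU}(2,1)=\{g\in \mathrm{SL}(3,\mathbb{C}) : g^*Hg=H\}$, $\mathcal{Q}(u,v)=u^*Hv$ on $\mathbb{C}^3$. Let $K=\{g\in G:(g^* )^{-1}=g\}$, $D=G/K$, $x_0=eK$. Every $z\in D$ is uniquely $z=u\,a\cdot x_0$ with $u=\begin{pmatrix}1&\beta&r+i|\beta|^2/2\\0&1&i\overline\beta\\0&0&1\end{pmatrix}$, $a=\mathrm{diag}(y,1,1/y)$, $\beta\in\mathbb{C}$, $r\in\mathbb{R}$, $y>0$; write $z=(y,\beta,r)$. A set such as $\{y^2=\dots\}$ denotes the set of points $(y,\beta,r)\in D$ satisfying the indicated conditions (square roots being real, nonnegative). $\mathcal{P}$ is the set of proper rational parabolic subgroups of $G$ (for the rational structure given by $\mathbb{Q}(i)$). Each $P\in\mathcal{P}$ is the stabilizer of the line spanned by a vector $v_P=(n,p,q)^t\in\mathbb{Z}[i]^3$ that is isotropic ($\mathcal{Q}(v_P,v_P)=0$) and reduced ($n,p,q$ generate the unit ideal), unique up to units $\{\pm1,\pm i\}$; this is a bijection between $\mathcal{P}$ and reduced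 isotropic vectors up to units. The exhaustion function of $P$ with $v_P=(n,p,q)^t$ is $$f_P(y,\beta,r)=\frac{y}{\left(|n-\beta p+(i|\beta|^2/2-r)q|^2+y^2|p-i\overline\beta q|^2+y^4|q|^2\right)^{1/2}}.$$ Let $D(P)=\{z\in D: f_P(z)\ge f_Q(z)\ \forall Q\in\mathcal{P}\setminus\{P\}\}$. For $\mathcal{I}\subseteq\mathcal{P}$ let $E(\mathcal{I})=\{z\in D: f_P(z)=f_Q(z)\ \forall P,Q\in\mathcal{I}\}$ and $D(\mathcal{I})=\bigcap_{P\in\mathcal{I}}D(P)$. $\mathcal{I}^i_j$ denotes the set of rational parabolic subgroups associated to the following set $\mathcal{J}^i_j$ of reduced isotropic vectors: $\mathcal{J}^2_1=\{(1,0,0)^t,(0,0,1)^t\}$, $\mathcal{J}^2_2=\{(1,0,0)^t,(i,1+i,1+i)^t\}$, $\mathcal{J}^3_1=\mathcal{J}^2_1\cup\{(1,0,1)^t\}$, $\mathcal{J}^3_2=\mathcal{J}^2_1\cup\{(i,1+i,1)^t\}$, $\mathcal{J}^3_3=\mathcal{J}^2_1\cup\{(1+i,1+i,1)^t\}$, $\mathcal{J}^4_1=\mathcal{J}^3_1\cup\{(i,1+i,1)^t\}$, $\mathcal{J}^4_2=\mathcal{J}^3_3\cup\{(-1,-1+i,1+i)^t\}$, $\mathcal{J}^5=\mathcal{J}^4_1\cup\{(1+i,1+i,1)^t\}$, $\mathcal{J}^8=\{(1,0,0)^t,(0,0,1)^t,(-1,1+i,1+i)^t,(-1+i,1+i,1)^t,(1+i,1-i,1)^t,(i,1+i,1+i)^t,(2i,2,1)^t,(i,2,2)^t\}$.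 *)

(* Defs.v *)
From HB Require Import structures.
From mathcomp Require Import all_boot all_order all_algebra.
From mathcomp Require Import complex.
From mathcomp Require Import boolp classical_sets reals.

Set Implicit Arguments.
Unset Strict Implicit.
Unset Printing Implicit Defensive.

Import Order.TTheory GRing.Theory Num.Theory.

Local Open Scope classical_set_scope.
Local Open Scope ring_scope.

Notation normc := ComplexField.Normc.normc.

Definition vec3 (R : realType) (n p q : R[i]) : 'cV[R[i]]_3 :=
  \col_i nth 0 [:: n; p; q] i.

Definition mat3 (R : realType) (rows : seq (seq R[i])) : 'M[R[i]]_3 :=
  \matrix_(i, j) nth 0 (nth [::] rows i) j.

Definition adjmx (R : realType) (m n : nat) (A : 'M[R[i]]_(m, n)) :
    'M[R[i]]_(n, m) :=
  (map_mx conjc A)^T.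

Definition Hmx (R : realType) : 'M[R[i]]_3 :=
  mat3 [:: [:: 0; 0; 'i%C]; [:: 0; -1; 0]; [:: - 'i%C; 0; 0]].

Definition Qform (R : realType) (u v : 'cV[R[i]]_3) : R[i] :=
  (adjmx u *m Hmx R *m v) 0 0.

Definition SU21 (R : realType) : set 'M[R[i]]_3 :=
  [set g | \det g = 1 /\ adjmx g *m Hmx R *m g = Hmx R].

Definition Kgrp (R : realType) : set 'M[R[i]]_3 :=
  [set g | SU21 g /\ invmx (adjmx g) = g].

(* The point g . x_0 of G / K is the left coset g K, as a set of matrices. *)
Definition cosetK (R : realType) (g : 'M[R[i]]_3) : set 'M[R[i]]_3 :=
  [set g *m k | k in @Kgrp R].

Definition symspace (R : realType) : set (set 'M[R[i]]_3) :=
  [set cosetK g | g in @SU21 R].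

Definition unip (R : realType) (beta : R[i]) (r : R) : 'M[R[i]]_3 :=
  mat3 [:: [:: 1; beta; (r +i* (normc beta ^+ 2 / 2))%C];
           [:: 0; 1; 'i%C * beta^*%C];
           [:: 0; 0; 1]].

Definition torus (R : realType) (y : R) : 'M[R[i]]_3 :=
  mat3 [:: [:: y%:C%C; 0; 0]; [:: 0; 1; 0]; [:: 0; 0; (y^-1)%:C%C]].

Definition pt (R : realType) (y : R) (beta : R[i]) (r : R) :
    set 'M[R[i]]_3 :=
  cosetK (unip beta r *m torus y).

(* By the Iwasawa decomposition every point of [symspace] has exactly one such
   triple; the default value is only reached outside [symspace]. *)
Definition coords (R : realType) (z : set 'M[R[i]]_3) : R * R[i] * R :=
  xget (1, 0, 0) [set t : R * R[i] * R |
    0 < t.1.1 /\ z = pt t.1.1 t.1.2 t.2].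

(* The points (y, beta, r) of [symspace] satisfying the condition [A].
   As [Num.sqrt x = 0] for [x < 0], an equation y^2 = - c + Num.sqrt x with
   c >= 0 already forces x >= 0, because y > 0. *)
Definition locus (R : realType) (A : R -> R[i] -> R -> Prop) :
    set (set 'M[R[i]]_3) :=
  [set z | exists y beta r, [/\ 0 < y, z = pt y beta r & A y beta r]].

Definition gaussian (R : realType) (x : R[i]) : Prop :=
  complex.Re x \is a Num.int /\ complex.Im x \is a Num.int.

Definition isotropic (R : realType) (v : 'cV[R[i]]_3) : Prop :=
  Qform v v = 0.

(* Gaussian-integer entries that generate the unit ideal of Z[i]. *)
Definition reduced (R : realType) (v : 'cV[R[i]]_3) : Prop :=
  (forall k, gaussian (v k 0)) /\
  exists a : 'rV[R[i]]_3, (forall k, gaussian (a 0 k)) /\ (a *m v) 0 0 = 1.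

Definition line_stab (R : realType) (v : 'cV[R[i]]_3) : set 'M[R[i]]_3 :=
  [set g | SU21 g /\ exists c : R[i], g *m v = c *: v].

(* The proper rational parabolic subgroups: the stabilizers in SU(2,1) of the
   isotropic lines defined over Q(i), each of which is spanned by a reduced
   vector. *)
Definition parabolic (R : realType) : set (set 'M[R[i]]_3) :=
  [set line_stab v | v in [set v : 'cV[R[i]]_3 | isotropic v /\ reduced v]].

(* A choice of v_P; it is unique up to a unit of Z[i], so that [exhaust] does
   not depend on it. *)
Definition pvec (R : realType) (P : set 'M[R[i]]_3) : 'cV[R[i]]_3 :=
  xget 0 [set v | [/\ isotropic v, reduced v & P = line_stab v]].

Definition exhaust_vec (R : realType) (v : 'cV[R[i]]_3)
    (y : R) (beta : R[i]) (r : R) : R :=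
  let n := v 0 0 in let p := v 1 0 in let q := v 2 0 in
  y / Num.sqrt
    (normc (n - beta * p + ((- r) +i* (normc beta ^+ 2 / 2))%C * q) ^+ 2
     + y ^+ 2 * normc (p - 'i%C * beta^*%C * q) ^+ 2
     + y ^+ 4 * normc q ^+ 2).

Definition exhaust (R : realType) (P z : set 'M[R[i]]_3) : R :=
  let: (y, beta, r) := coords z in exhaust_vec (pvec P) y beta r.

Definition D1 (R : realType) (P : set 'M[R[i]]_3) : set (set 'M[R[i]]_3) :=
  [set z | symspace z /\
    forall Q, parabolic Q -> Q <> P -> exhaust Q z <= exhaust P z].

Definition D (R : realType) (I : set (set 'M[R[i]]_3)) :
    set (set 'M[R[i]]_3) :=
  \bigcap_(P in I) D1 P.

Definition E (R : realType) (I : set (set 'M[R[i]]_3)) :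
    set (set 'M[R[i]]_3) :=
  [set z | symspace z /\
    forall P Q, I P -> I Q -> exhaust P z = exhaust Q z].

Definition J21 (R : realType) : seq 'cV[R[i]]_3 :=
  [:: vec3 1 0 0; vec3 0 0 1].
Definition J22 (R : realType) : seq 'cV[R[i]]_3 :=
  [:: vec3 1 0 0; vec3 'i%C (1 + 'i%C) (1 + 'i%C)].
Definition J31 (R : realType) : seq 'cV[R[i]]_3 :=
  J21 R ++ [:: vec3 1 0 1].
Definition J32 (R : realType) : seq 'cV[R[i]]_3 :=
  J21 R ++ [:: vec3 'i%C (1 + 'i%C) 1].
Definition J33 (R : realType) : seq 'cV[R[i]]_3 :=
  J21 R ++ [:: vec3 (1 + 'i%C) (1 + 'i%C) 1].
Definition J41 (R : realType) : seq 'cV[R[i]]_3 :=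
  J31 R ++ [:: vec3 'i%C (1 + 'i%C) 1].
Definition J42 (R : realType) : seq 'cV[R[i]]_3 :=
  J33 R ++ [:: vec3 (-1) (-1 + 'i%C) (1 + 'i%C)].
Definition J5 (R : realType) : seq 'cV[R[i]]_3 :=
  J41 R ++ [:: vec3 (1 + 'i%C) (1 + 'i%C) 1].
Definition J8 (R : realType) : seq 'cV[R[i]]_3 :=
  [:: vec3 1 0 0; vec3 0 0 1; vec3 (-1) (1 + 'i%C) (1 + 'i%C);
      vec3 (-1 + 'i%C) (1 + 'i%C) 1; vec3 (1 + 'i%C) (1 - 'i%C) 1;
      vec3 'i%C (1 + 'i%C) (1 + 'i%C); vec3 (2 * 'i%C) 2 1; vec3 'i%C 2 2].

Definition assoc_parab (R : realType) (J : seq 'cV[R[i]]_3) :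
    set (set 'M[R[i]]_3) :=
  [set line_stab v | v in [set` J]].

Definition I21 (R : realType) := assoc_parab (J21 R).
Definition I22 (R : realType) := assoc_parab (J22 R).
Definition I31 (R : realType) := assoc_parab (J31 R).
Definition I32 (R : realType) := assoc_parab (J32 R).
Definition I33 (R : realType) := assoc_parab (J33 R).
Definition I41 (R : realType) := assoc_parab (J41 R).
Definition I42 (R : realType) := assoc_parab (J42 R).
Definition I5 (R : realType) := assoc_parab (J5 R).
Definition I8 (R : realType) := assoc_parab (J8 R).

Arguments I21 R : clear implicits.
Arguments I22 R : clear implicits.
Arguments I31 R : clear implicits.
Arguments I32 R : clear implicits.
Arguments I33 R : clear implicits.
Arguments I41 R : clear implicits.
Arguments I42 R : clear implicits.
Arguments I5 R : clear implicits.
Arguments I8 R : clear implicits.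

(* Main.v *)
Require Import Defs.
From HB Require Import structures.
From mathcomp Require Import all_boot all_order all_algebra.
From mathcomp Require Import complex.
From mathcomp Require Import boolp classical_sets reals.
From mathcomp Require Import ring lra zify.
Import Order.TTheory GRing.Theory Num.Theory.
Local Open Scope classical_set_scope.
Local Open Scope ring_scope.

(** For an isotropic vector v = (n, p, q) the quantity under the root in f_P is
    |n - beta p + (- r + i tau) q|^2 with tau = y^2 + |beta|^2 / 2, so that
    f_P = y / |L_v| for a linear form L_v, and first-contact sets are described
    by |L_v| = 1 for v in J together with |L_w| >= 1 for all reduced isotropic
    w.  The lower bound
    on y in (iii) is a covering argument: writing - r + i tau = i exp (i phi),
    s = tan (phi / 2) and X + i Z = (1 + i) (1 - i s) beta, the conditions
    |L_w| >= 1 for the vectors (i + m, (1 + i) u, 1) and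
    (i, (1 + i) u, 1 + m i), with |m| <= 1 and u a unit, keep (X, Z) outside a
    family of discs of the same radius which cover the annulus
    corresponding to 0 < y^2 <= 9/20.  At the point of (xi) the L_w are
    Gaussian integers.  At the point of (x) they are of the form
    m + q (-1 + i sqrt 3) / 2 with m, q in Z[i], so that |L_w|^2 is a positive
    integer plus sqrt 3 Im (m q^* ), and a negative Im (m q^* ) forces |q| >= 2
    and |L_w|^2 >= y^4 |q|^2 >= 1. *)

Set Implicit Arguments.
Unset Strict Implicit.
Unset Printing Implicit Defensive.

(** * Entrywise formulas for 3 x 3 matrices *)

Lemma sum_ord3 (V : nmodType) (F : 'I_3 -> V) : \sum_i F i = F 0 + F 1 + F 2.
Proof.
rewrite !big_ord_recl big_ord0 addr0 addrA.
by congr (F _ + F _ + F _); apply: val_inj.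
Qed.

Lemma ord3_ind (P : 'I_3 -> Prop) : P 0 -> P 1 -> P 2 -> forall i, P i.
Proof.
move=> P0 P1 P2 [[|[|[|//]]] lti].
- by rewrite (_ : Ordinal lti = 0) //; apply: val_inj.
- by rewrite (_ : Ordinal lti = 1) //; apply: val_inj.
- by rewrite (_ : Ordinal lti = 2) //; apply: val_inj.
Qed.

Lemma mulmx3E (R : pzRingType) m n (A : 'M[R]_(m, 3)) (B : 'M[R]_(3, n)) i j :
  (A *m B) i j = A i 0 * B 0 j + A i 1 * B 1 j + A i 2 * B 2 j.
Proof. by rewrite mxE sum_ord3. Qed.

Lemma det_mx33 (R : comPzRingType) (A : 'M[R]_3) :
  \det A = A 0 0 * (A 1 1 * A 2 2 - A 1 2 * A 2 1)
         - A 0 1 * (A 1 0 * A 2 2 - A 1 2 * A 2 0)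
         + A 0 2 * (A 1 0 * A 2 1 - A 1 1 * A 2 0).
Proof.
rewrite (expand_det_row _ 0) sum_ord3 /cofactor.
have l00 : lift (0 : 'I_3) (0 : 'I_2) = 1 by apply: val_inj.
have l01 : lift (0 : 'I_3) (1 : 'I_2) = 2 by apply: val_inj.
have l10 : lift (1 : 'I_3) (0 : 'I_2) = 0 by apply: val_inj.
have l11 : lift (1 : 'I_3) (1 : 'I_2) = 2 by apply: val_inj.
have l20 : lift (2 : 'I_3) (0 : 'I_2) = 0 by apply: val_inj.
have l21 : lift (2 : 'I_3) (1 : 'I_2) = 1 by apply: val_inj.
have det2 (B : 'M[R]_2) : \det B = B 0 0 * B 1 1 - B 0 1 * B 1 0.
  rewrite (expand_det_row _ 0) !big_ord_recl big_ord0 /cofactor.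
  rewrite !det_mx11 !mxE /=.
  have k1 : lift (0 : 'I_2) 0 = 1 by apply: val_inj.
  have k2 : lift (1 : 'I_2) 0 = 0 by apply: val_inj.
  rewrite ?k1 ?k2 /= /bump /=; ring.
rewrite !det2 !mxE !(l00, l01, l10, l11, l20, l21) /= !modn_small //=.
ring.
Qed.

(** * Conjugate transpose and the matrix of the form *)

Section Mx.
Variable R : realType.
Implicit Types (A B g k : 'M[R[i]]_3).

Lemma adjmxE m n (A : 'M[R[i]]_(m, n)) i j : adjmx A i j = (A j i)^*%C.
Proof. by rewrite !mxE. Qed.

Lemma adjmxM m n p (A : 'M[R[i]]_(m, n)) (B : 'M[R[i]]_(n, p)) :
  adjmx (A *m B) = adjmx B *m adjmx A.
Proof. by rewrite /adjmx map_mxM trmx_mul. Qed.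

Lemma adjmxK m n (A : 'M[R[i]]_(m, n)) : adjmx (adjmx A) = A.
Proof. by apply/matrixP => i j; rewrite !adjmxE conjcK. Qed.

Lemma adjmx1 n : adjmx (1%:M : 'M[R[i]]_n) = 1%:M.
Proof. by rewrite /adjmx map_mx1 trmx1. Qed.

Lemma det_adjmx n (A : 'M[R[i]]_n) : \det (adjmx A) = (\det A)^*%C.
Proof. by rewrite det_tr det_map_mx. Qed.

Lemma HmxE : [/\ Hmx R 0 0 = 0, Hmx R 0 1 = 0 & Hmx R 0 2 = 'i%C] /\
  [/\ Hmx R 1 0 = 0, Hmx R 1 1 = -1 & Hmx R 1 2 = 0] /\
  [/\ Hmx R 2 0 = - 'i%C, Hmx R 2 1 = 0 & Hmx R 2 2 = 0].
Proof. by rewrite !mxE. Qed.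

Lemma adjmx_Hmx : adjmx (Hmx R) = Hmx R.
Proof.
apply/matrixP => i j; elim/ord3_ind: i; elim/ord3_ind: j;
 rewrite adjmxE !mxE /=; apply/eqP;
  by rewrite eq_complex /= ?oppr0 ?opprK ?eqxx.
Qed.

Lemma Hmx_sqr : Hmx R *m Hmx R = 1%:M.
Proof.
apply/matrixP => i j; elim/ord3_ind: i; elim/ord3_ind: j;
 rewrite mulmx3E !mxE /=; apply/eqP; rewrite eq_complex /=;
  apply/andP; split; apply/eqP; ring.
Qed.
End Mx.

(** * The group, cosets of K as Gram matrices, uniqueness of coordinates *)

Section Sym.
Variable R : realType.
Implicit Types (A B g k : 'M[R[i]]_3).

Lemma SU21_1 : SU21 (1%:M : 'M[R[i]]_3).
Proof. by split; rewrite ?det1// adjmx1 mul1mx mulmx1. Qed.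

Lemma SU21_mul A B : SU21 A -> SU21 B -> SU21 (A *m B).
Proof.
move=> [dA hA] [dB hB]; split; first by rewrite det_mulmx dA dB mulr1.
by rewrite adjmxM !mulmxA -(mulmxA _ _ (Hmx R)) -(mulmxA _ _ A) hA.
Qed.

Lemma SU21_unit A : SU21 A -> A \in unitmx.
Proof. by move=> [dA _]; rewrite unitmxE dA unitr1. Qed.

Lemma SU21_inv A : SU21 A -> SU21 (invmx A).
Proof.
move=> sA; have uA := SU21_unit sA; case: sA => dA hA.
split; first by rewrite det_inv dA invr1.
rewrite -{1}hA !mulmxA -adjmxM mulmxV // adjmx1 mul1mx -mulmxA mulmxV //.
by rewrite mulmx1.
Qed.

(** Since [Hmx R] is an involution, the defining relation makes H A^* H a left inverse of A. It is
    then a right inverse as well, which is the relation for A^*. *)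
Lemma SU21_adj A : SU21 A -> A *m Hmx R *m adjmx A = Hmx R.
Proof.
move=> sA; have uA := SU21_unit sA; case: sA => dA hA.
have : Hmx R *m adjmx A *m Hmx R *m A = 1%:M.
  by rewrite -!mulmxA (mulmxA (adjmx A)) hA Hmx_sqr.
move=> /mulmx1C; rewrite !mulmxA => h.
by rewrite -[LHS]mulmx1 -Hmx_sqr !mulmxA h mul1mx.
Qed.

Lemma KgrpP k : Kgrp k <-> SU21 k /\ k *m adjmx k = 1%:M.
Proof.
split=> -[sk hk]; split=> //.
  rewrite -{1}hk mulVmx // unitmxE det_adjmx.
  by have [-> _] := sk; rewrite conjc1 unitr1.
have uk := SU21_unit sk.
rewrite -[RHS]mulmx1 -(@mulmxV _ _ (adjmx k)); last first.
  by rewrite unitmxE det_adjmx; have [-> _] := sk; rewrite conjc1 unitr1.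
by rewrite mulmxA hk mul1mx.
Qed.

(** Elements of K are unitary, so the Gram matrix depends on the coset only; conversely, equal Gram
    matrices make B^-1 A unitary. From here on a point of the symmetric space is handled through its
    Gram matrix. *)
Lemma cosetK_eq A B : SU21 A -> SU21 B ->
  cosetK A = cosetK B <-> A *m adjmx A = B *m adjmx B.
Proof.
move=> sA sB; have uA := SU21_unit sA; have uB := SU21_unit sB.
have K1 : Kgrp (1%:M : 'M[R[i]]_3).
  by apply/KgrpP; split; [exact: SU21_1 | rewrite adjmx1 mulmx1].
split=> [e|e].
  have : cosetK A A by exists 1%:M; rewrite ?mulmx1.
  rewrite e => -[k /KgrpP[_ hk] <-].
  by rewrite adjmxM !mulmxA -(mulmxA B) hk mulmx1.
suff sub (A1 B1 : 'M[R[i]]_3) : SU21 A1 -> SU21 B1 ->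
    A1 *m adjmx A1 = B1 *m adjmx B1 -> cosetK A1 `<=` cosetK B1.
  by rewrite eqEsubset; split; apply: sub.
move=> {sA sB uA uB e A B} sA sB e x [k /KgrpP[sk hk] <-].
have uB := SU21_unit sB.
exists (invmx B1 *m (A1 *m k)); last by rewrite !mulmxA mulmxV// mul1mx.
apply/KgrpP; split.
  by apply: SU21_mul; [exact: SU21_inv | exact: SU21_mul].
rewrite !adjmxM !mulmxA -(mulmxA _ k) hk mulmx1 -(mulmxA _ A1) e !mulmxA.
by rewrite mulVmx // mul1mx -adjmxM mulVmx // adjmx1.
Qed.

Definition iwasawa (y : R) (beta : R[i]) (r : R) : 'M[R[i]]_3 :=
  unip beta r *m torus y.

Lemma sqr_normc (z : R[i]) :
  normc z ^+ 2 = complex.Re z ^+ 2 + complex.Im z ^+ 2.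
Proof. by case: z => a b /=; rewrite sqr_sqrtr // addr_ge0 ?sqr_ge0. Qed.

Lemma iwasawaE y beta r : let w := iwasawa y beta r in
  [/\ w 0 0 = y%:C%C, w 0 1 = beta &
      w 0 2 = (r +i* (normc beta ^+ 2 / 2))%C * (y^-1)%:C%C] /\
  [/\ w 1 0 = 0, w 1 1 = 1 & w 1 2 = 'i%C * beta^*%C * (y^-1)%:C%C] /\
  [/\ w 2 0 = 0, w 2 1 = 0 & w 2 2 = (y^-1)%:C%C].
Proof.
rewrite /iwasawa !mulmx3E !mxE /=.
by rewrite !(mul0r, mulr0, mul1r, mulr1, addr0, add0r).
Qed.

Lemma eq_complexP (z w : R[i]) :
  complex.Re z = complex.Re w -> complex.Im z = complex.Im w -> z = w.
Proof. by case: z w => a b [c d] /= -> ->. Qed.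

Lemma SU21_iwasawa (y : R) beta r : 0 < y -> SU21 (iwasawa y beta r).
Proof.
move=> y0; have yn0 : y != 0 by rewrite gt_eqF.
have := iwasawaE y beta r; move: (iwasawa y beta r) => w /=.
move=> [[w00 w01 w02] [[w10 w11 w12] [w20 w21 w22]]]; split.
  rewrite det_mx33 w00 w01 w02 w10 w11 w12 w20 w21 w22.
  rewrite !(mul0r, mulr0, mul1r, mulr1, subr0, addr0).
  by rewrite -rmorphM mulfV.
have [[h00 h01 h02] [[h10 h11 h12] [h20 h21 h22]]] := HmxE R.
apply/matrixP => i j; elim/ord3_ind: i; elim/ord3_ind: j;
  rewrite !mulmx3E !adjmxE ?h00 ?h01 ?h02 ?h10 ?h11 ?h12 ?h20 ?h21 ?h22
   ?w00 ?w01 ?w02 ?w10 ?w11 ?w12 ?w20 ?w21 ?w22 ?sqr_normc;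
  case: beta {w00 w01 w02 w10 w11 w12 w20 w21 w22} => b c;
  apply: eq_complexP; rewrite /=; by field.
Qed.

(** The last column is all that is needed: its entries yield y, then beta, then r, both for
    uniqueness and for existence of the coordinates. *)
Lemma gram_iwasawa y beta r : let w := iwasawa y beta r in
  let S := w *m adjmx w in
  [/\ S 2 2 = (y^-2)%:C%C, S 1 2 = 'i%C * beta^*%C * (y^-2)%:C%C &
      S 0 2 = (r +i* (normc beta ^+ 2 / 2))%C * (y^-2)%:C%C].
Proof.
have := iwasawaE y beta r; move: (iwasawa y beta r) => w /=.
move=> [[w00 w01 w02] [[w10 w11 w12] [w20 w21 w22]]].
rewrite !mulmx3E !adjmxE w00 w01 w02 w10 w11 w12 w20 w21 w22.
rewrite -[in y ^- 2]exprVn.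
by split; case: (beta) => b c; apply: eq_complexP; rewrite /=; ring.
Qed.

Lemma pt_inj (y : R) beta (r y' : R) beta' (r' : R) : 0 < y -> 0 < y' ->
  pt y beta r = pt y' beta' r' -> [/\ y = y', beta = beta' & r = r'].
Proof.
move=> y0 y'0 /cosetK_eq.
move=> /(_ (SU21_iwasawa _ _ y0)) /(_ (SU21_iwasawa _ _ y'0)) e.
have [s22 s12 s02] := gram_iwasawa y beta r.
have [t22 t12 t02] := gram_iwasawa y' beta' r'.
move: s22 s12 s02; rewrite [_ *m adjmx _]e t22 t12 t02.
move=> [/invr_inj e2].
have ey : y = y'.
  apply/eqP; rewrite -(eqrXn2 (n := 2)) ?ltW //.
  by rewrite e2.
subst y'.
have k0 : (y ^- 2)%:C%C != 0 :> R[i].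
  by rewrite eq_complex /= eqxx andbT invr_eq0 expf_eq0 /= gt_eqF.
move=> /(mulIf k0) /mulfI e1 /(mulIf k0) [-> _].
split=> //; apply: (can_inj (@conjcK _)); rewrite e1 //.
by rewrite eq_complex /= eqxx oner_eq0.
Qed.
End Sym.

(** * Existence of Iwasawa coordinates *)

Section Iwa.
Variable R : realType.
Implicit Types (A B g k : 'M[R[i]]_3).

Lemma gram_form g : SU21 g -> let S := g *m adjmx g in S *m Hmx R *m S = Hmx R.
Proof.
move=> sg /=.
have <- : g *m (adjmx g *m Hmx R *m g) *m adjmx g =
    g *m adjmx g *m Hmx R *m (g *m adjmx g) by rewrite !mulmxA.
by case: (sg) => _ ->; exact: SU21_adj.
Qed.

Lemma gram_sym g : let S := g *m adjmx g in forall i j, S i j = (S j i)^*%C.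
Proof. by move=> S i j; rewrite -adjmxE adjmxM adjmxK. Qed.

Lemma gram_diag g i : let S := g *m adjmx g in
  complex.Im (S i i) = 0 /\
  complex.Re (S i i) =
    normc (g i 0) ^+ 2 + normc (g i 1) ^+ 2 + normc (g i 2) ^+ 2.
Proof.
rewrite /= mulmx3E !adjmxE !sqr_normc.
by case: (g i 0) (g i 1) (g i 2) => [a b] [c d] [e f] /=; split; ring.
Qed.

(** For T = k k^*, the relation T H T = H determines T from its last column: entry (0, 2) gives T00
    = 1, entry (0, 0) gives |T01|^2 = 0, and entry (1, 1) gives T11^2 = 1, where -1 is excluded
    because T11 is a sum of squares. *)
Lemma gram_eq1 k : SU21 k ->
  (k *m adjmx k) 0 2 = 0 -> (k *m adjmx k) 1 2 = 0 ->
  (k *m adjmx k) 2 2 = 1 -> k *m adjmx k = 1%:M.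
Proof.
move=> sk; have := gram_form sk; have := gram_sym k; have := gram_diag k 1.
move: (k *m adjmx k) => T /= [im1 re1] sym THT t02 t12 t22.
have t20 : T 2 0 = 0 by rewrite sym t02 conjc0.
have t21 : T 2 1 = 0 by rewrite sym t12 conjc0.
have [[h00 h01 h02] [[h10 h11 h12] [h20 h21 h22]]] := HmxE R.
have := congr1 (fun M : 'M_3 => M 0 2) THT.
rewrite /= !mulmx3E ?h00 ?h01 ?h02 ?h10 ?h11 ?h12 ?h20 ?h21 ?h22.
rewrite t22 t12 t02 !(mulr0, mul0r, add0r, addr0, mulr1) => /eqP.
rewrite -{2}['i%C]mul1r (inj_eq (mulIf _)); last first.
  by rewrite eq_complex /= oner_eq0 andbF.
move=> /eqP t00.
have := congr1 (fun M : 'M_3 => M 0 0) THT.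
rewrite /= !mulmx3E ?h00 ?h01 ?h02 ?h10 ?h11 ?h12 ?h20 ?h21 ?h22.
rewrite t20 t02 (sym 1 0) !(mulr0, mul0r, add0r, addr0, mulr1).
rewrite mulrN1 mulNr => /eqP.
rewrite oppr_eq0 mulf_eq0 conjc_eq0 orbb => /eqP t01.
have t10 : T 1 0 = 0 by rewrite sym t01 conjc0.
have := congr1 (fun M : 'M_3 => M 1 1) THT.
rewrite /= !mulmx3E ?h00 ?h01 ?h02 ?h10 ?h11 ?h12 ?h20 ?h21 ?h22.
rewrite t21 t12 t10 !(mulr0, mul0r, add0r, addr0, mulr1).
rewrite mulrN1 mulNr => /oppr_inj /eqP; rewrite -expr2 sqrf_eq1.
have t11 : T 1 1 != -1.
  apply/eqP => e; move: re1; rewrite e /= => h.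
  have : 0 <= - (1:R) by rewrite h !addr_ge0 ?sqr_ge0.
  by rewrite oppr_ge0 leNgt ltr01.
rewrite (negbTE t11) orbF => /eqP t11'.
by apply/matrixP => i j; elim/ord3_ind: i; elim/ord3_ind: j; rewrite !mxE.
Qed.

(** The coordinates are read off the last column of S = g g^*. If w is the Iwasawa matrix with these
    coordinates and g = w k, then S and w w^* share their last column, so [gram_eq1] applies to
    k. *)
Lemma iwasawa_exists g : SU21 g ->
  exists (y : R) (beta : R[i]) (r : R), 0 < y /\ cosetK g = pt y beta r.
Proof.
move=> sg; have := gram_form sg; have := gram_sym g.
have /= [] := gram_diag g 2.
set S := g *m adjmx g => im2 re2 sym SHS.
have ge0 : 0 <= complex.Re (S 2 2) by rewrite re2 !addr_ge0 ?sqr_ge0.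
have [[h00 h01 h02] [[h10 h11 h12] [h20 h21 h22]]] := HmxE R.
have gt0 : 0 < complex.Re (S 2 2).
  rewrite lt_def ge0 andbT; apply/eqP => re0.
  have e0 i : g 2 i = 0.
    move: re2; rewrite re0 => /esym/eqP.
    rewrite !paddr_eq0 ?addr_ge0 ?sqr_ge0 // !expf_eq0 /= -andbA.
    move=> /and3P[/eqP/ComplexField.Normc.eq0_normc a
      /eqP/ComplexField.Normc.eq0_normc b /eqP/ComplexField.Normc.eq0_normc c].
    by elim/ord3_ind: i.
  case: sg => dg _; move: dg; rewrite det_mx33 !e0 => /esym/eqP.
  by rewrite !(mulr0, mul0r, subr0, addr0) oner_eq0.
have SE : S = g *m adjmx g by [].
move: SE; clearbody S => SE.
(* This entry says that the last column of S is isotropic, which forces the imaginary part of S 0 2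
   to be rho |beta|^2 / 2. *)
have := congr1 (fun M : 'M_3 => M 2 2) SHS.
rewrite /= !mulmx3E ?h00 ?h01 ?h02 ?h10 ?h11 ?h12 ?h20 ?h21 ?h22.
rewrite (sym 2 0) (sym 2 1).
set rho := complex.Re (S 2 2) in ge0 gt0 *.
have S22 : S 2 2 = rho%:C%C by apply: eq_complexP; rewrite //= im2.
rewrite S22.
case S02 : (S 0 2) => [n1 n2]; case S12 : (S 1 2) => [p1 p2] /= [iso _].
have rn0 : rho != 0 by rewrite gt_eqF.
(* The entry S 1 2 should be i rho times the conjugate of beta, so real and imaginary parts trade
   places. *)
pose y := Num.sqrt rho^-1; pose beta := (p2 / rho +i* (p1 / rho))%C.
pose r := n1 / rho.
have y0 : 0 < y by rewrite sqrtr_gt0 invr_gt0.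
have y2 : y ^- 2 = rho by rewrite sqr_sqrtr ?invr_ge0 // invrK.
exists y, beta, r; split=> //.
have := iwasawaE y beta r; have := gram_iwasawa y beta r.
have := SU21_iwasawa beta r y0; rewrite /pt -/(iwasawa y beta r).
move: (iwasawa y beta r) => w sw /= [t22 t12 t02] [_ [_ [w20 w21 w22]]].
have uw := SU21_unit sw.
have [k gE sk] : exists2 k, g = w *m k & SU21 k.
  exists (invmx w *m g); first by rewrite mulmxA mulmxV // mul1mx.
  by apply: SU21_mul => //; exact: SU21_inv.
have Swk : S = w *m (k *m adjmx k *m adjmx w).
  by rewrite SE gE adjmxM !mulmxA.
apply/cosetK_eq => //; rewrite -SE Swk.
suff -> : k *m adjmx k = 1%:M by rewrite mul1mx.
have yn0 : (y^-1)%:C%C != 0 by rewrite eq_complex /= eqxx andbT invr_eq0 gt_eqF.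
have Scol i : S i 2 = (w *m adjmx w) i 2.
  elim/ord3_ind: i; rewrite ?S02 ?S12 ?S22 ?t02 ?t12 ?t22 y2 //.
    rewrite sqr_sqrtr ?addr_ge0 ?sqr_ge0 //; apply: eq_complexP; rewrite /= /r.
      by rewrite mulr0 subr0 divfK.
    rewrite mulr0 add0r !expr_div_n -mulrDl.
    have -> : p2 ^+ 2 + p1 ^+ 2 = 2 * (n2 * rho) by move: iso; lra.
    by field.
  by apply: eq_complexP; rewrite /=; field.
have Skk : k *m adjmx k *m adjmx w = invmx w *m S by rewrite Swk mulKmx.
(* The last row of w is (0, 0, 1/y), so right multiplication by w^* only rescales the last column of
   k k^*. *)
have kcol i : (k *m adjmx k) i 2 = (w 2 i)^*%C / (y^-1)%:C%C.
  apply: (mulIf yn0); rewrite divfK //.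
  have := congr1 (fun M : 'M_3 => M i 2) Skk.
  rewrite /= mulmx3E [RHS]mulmx3E !Scol -[RHS]mulmx3E mulKmx // !adjmxE.
  by rewrite w20 w21 w22 conjc0 conjc_real !mulr0 !add0r.
apply: gram_eq1 => //; rewrite kcol ?w20 ?w21 ?w22 ?conjc0 ?mul0r //.
by rewrite conjc_real divff.
Qed.
End Iwa.

(** * Isotropic lines and exhaustion functions *)

Section Par.
Variable R : realType.
Implicit Types (u v w : 'cV[R[i]]_3) (c : R[i]).

Lemma QformE u v : Qform u v =
  'i%C * ((u 0 0)^*%C * v 2 0 - (u 2 0)^*%C * v 0 0) - (u 1 0)^*%C * v 1 0.
Proof.
have [[h00 h01 h02] [[h10 h11 h12] [h20 h21 h22]]] := HmxE R.
rewrite /Qform !mulmx3E !adjmxE h00 h01 h02 h10 h11 h12 h20 h21 h22; ring.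
Qed.

Lemma QformC u v : Qform u v = (Qform v u)^*%C.
Proof.
rewrite !QformE.
case: (v 0 0) (v 1 0) (v 2 0) (u 0 0) (u 1 0) (u 2 0)
  => [a1 b1] [a2 b2] [a3 b3] [a4 b4] [a5 b5] [a6 b6].
by apply: eq_complexP => /=; ring.
Qed.

Lemma isotropicE v : isotropic v <->
  normc (v 1 0) ^+ 2 = 2 * complex.Im (v 0 0 * (v 2 0)^*%C).
Proof.
rewrite /isotropic QformE sqr_normc.
case: (v 0 0) (v 1 0) (v 2 0) => [a b] [c d] [e f] /=.
split=> [[h _]|h]; last apply: eq_complexP => /=; [move: h|move: h|]; lra.
Qed.

Lemma cV3_eq u v : u 0 0 = v 0 0 -> u 1 0 = v 1 0 -> u 2 0 = v 2 0 -> u = v.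
Proof.
by move=> e0 e1 e2; apply/matrixP => i j; rewrite (ord1 j); elim/ord3_ind: i.
Qed.

(* The unipotent element x |-> x + i Q(v, x) v, which fixes v. *)
Definition transvection v : 'M[R[i]]_3 :=
  1%:M + 'i%C *: (v *m (adjmx v *m Hmx R)).

Lemma transvectionE v w :
  transvection v *m w = w + ('i%C * Qform v w) *: v.
Proof.
rewrite mulmxDl mul1mx -scalemxAl -!mulmxA -scalerA; congr (_ + _ *: _).
apply/matrixP => i j; rewrite !mxE big_ord1 (ord1 j) /Qform mulrC.
by rewrite -mulmxA.
Qed.

(** A rank one perturbation 1 + i v h, with h = v^* H, has determinant 1 + i h(v), and h(v) = Q(v,
    v) = 0. In the invariance of the form the first order terms cancel and the second order term
    contains Q(v, v). *)
Lemma SU21_transvection v : isotropic v -> SU21 (transvection v).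
Proof.
move=> iso; split.
  have [[h00 h01 h02] [[h10 h11 h12] [h20 h21 h22]]] := HmxE R.
  have E i j : transvection v i j =
      (i == j)%:R + 'i%C * (v i 0 * (adjmx v *m Hmx R) 0 j).
    by rewrite mxE [X in X + _]mxE [X in _ + X]mxE [X in _ * X]mxE big_ord1.
  rewrite det_mx33 !E.
  have : 'i%C * Qform v v = 0 by rewrite iso mulr0.
  rewrite /Qform mulmx3E => Q0.
  transitivity (1 + 'i%C * ((adjmx v *m Hmx R) 0 0 * v 0 0 +
    (adjmx v *m Hmx R) 0 1 * v 1 0 + (adjmx v *m Hmx R) 0 2 * v 2 0)).
    by move: (adjmx v *m Hmx R) => M /=; ring.
  by rewrite Q0 addr0.
have Q0 : adjmx v *m Hmx R *m v = 0.
  by apply/matrixP => i j; rewrite !ord1 [LHS]iso mxE.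
have adjT : adjmx (transvection v) = 1%:M - 'i%C *: (Hmx R *m v *m adjmx v).
  rewrite (_ : Hmx R *m v *m _ = adjmx (v *m (adjmx v *m Hmx R))); last first.
    by rewrite !adjmxM adjmxK adjmx_Hmx.
  apply/matrixP => i j; rewrite adjmxE [LHS]/= mxE [RHS]mxE [X in _ = _ + X]mxE.
  rewrite [X in _ = _ - X]mxE !adjmxE rmorphD /=.
  rewrite [X in _ + (X)^*%C = _]mxE rmorphM /= -mulNr; congr (_ + _ * _).
    by rewrite !mxE eq_sym; case: eqP => _; rewrite ?conjc0 ?conjc1.
  by apply: eq_complexP; rewrite /= ?oppr0.
rewrite adjT /transvection mulmxDl mulNmx mul1mx mulmxDr mulmx1 mulmxBl.
rewrite -!scalemxAl -!scalemxAr !mulmxA.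
have -> : Hmx R *m v *m adjmx v *m Hmx R *m v *m adjmx v *m Hmx R = 0.
  by rewrite -2!(mulmxA (Hmx R *m v)) Q0 mulmx0 !mul0mx.
by rewrite !scaler0 subr0 subrK.
Qed.

(** An isotropic vector with last entry 0 is a multiple of (1, 0, 0), which settles the case where v
    has last entry 0. Otherwise choose c so that u = v - c w has last entry 0: u is again isotropic
    and orthogonal to v, and pairing it with v shows u = 0. *)
Lemma isotropic_orthogonal v w : isotropic v -> isotropic w -> Qform v w = 0 ->
  v != 0 -> w != 0 -> exists2 c, c != 0 & v = c *: w.
Proof.
have i0 : 'i%C != 0 :> R[i] by rewrite eq_complex /= oner_eq0 andbF.
have tail0 u : isotropic u -> u 2 0 = 0 -> u 1 0 = 0.
  move=> /isotropicE iu u2; move: iu; rewrite u2 conjc0 mulr0 /= mulr0 => /eqP.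
  by rewrite expf_eq0 => /andP[_ /eqP/ComplexField.Normc.eq0_normc].
have head0 u : isotropic u -> u != 0 -> u 2 0 = 0 -> u 0 0 != 0.
  move=> iu u0 u2; apply: contra u0 => /eqP u00; apply/eqP.
  by apply: cV3_eq; rewrite mxE // tail0.
move=> iv iw vw v0 w0.
have [v2|v2] := eqVneq (v 2 0) 0.
  have v1 := tail0 _ iv v2; have v00 := head0 _ iv v0 v2.
  have w2 : w 2 0 = 0.
    move: vw; rewrite QformE v1 v2 !conjc0 !mul0r !subr0 => /eqP.
    by rewrite !mulf_eq0 (negbTE i0) conjc_eq0 (negbTE v00) => /eqP.
  have w1 := tail0 _ iw w2; have w00 := head0 _ iw w0 w2.
  exists (v 0 0 / w 0 0); first by rewrite mulf_neq0 ?invr_eq0.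
  by apply: cV3_eq; rewrite mxE ?divfK ?v1 ?w1 ?v2 ?w2 ?mulr0.
have w2 : w 2 0 != 0.
  apply/eqP => w2; have w1 := tail0 _ iw w2; have w00 := head0 _ iw w0 w2.
  move: vw; rewrite QformE w1 w2 !mulr0 sub0r subr0 => /eqP.
  rewrite !mulf_eq0 (negbTE i0) oppr_eq0 mulf_eq0 conjc_eq0.
  by rewrite (negbTE v2) (negbTE w00).
pose c := v 2 0 / w 2 0; have c0 : c != 0 by rewrite mulf_neq0 ?invr_eq0.
exists c => //; apply/eqP; rewrite -subr_eq0; apply/eqP.
set u := v - c *: w.
have u2 : u 2 0 = 0 by rewrite !mxE divfK // subrr.
have wv : Qform w v = 0 by rewrite QformC vw conjc0.
have QB x y z : Qform x (y - c *: z) = Qform x y - c * Qform x z.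
  by rewrite !QformE !mxE; ring.
have vu : Qform v u = 0 by rewrite QB iv vw mulr0 subr0.
have iu : isotropic u.
  have wu : Qform w u = 0 by rewrite QB wv iw mulr0 subr0.
  have -> : isotropic u = (Qform u v - c * Qform u w = 0) by rewrite -QB.
  by rewrite (QformC u v) (QformC u w) vu wu !conjc0 mulr0 subr0.
have u1 := tail0 _ iu u2.
apply: cV3_eq; rewrite ?[RHS]mxE //.
move: vu; rewrite QformE u1 u2 !mulr0 sub0r subr0 => /eqP.
rewrite !mulf_eq0 (negbTE i0) oppr_eq0 mulf_eq0 conjc_eq0.
by rewrite (negbTE v2) => /eqP.
Qed.

(* The transvection of v stabilizes the line of w only if Q(v, w) = 0, and in
   signature (2, 1) orthogonal isotropic vectors are proportional. *)
Lemma line_stab_inj v w : isotropic v -> isotropic w -> v != 0 -> w != 0 ->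
  line_stab v = line_stab w -> exists2 c, c != 0 & v = c *: w.
Proof.
move=> iv iw v0 w0 e; have [vw|vw] := eqVneq (Qform v w) 0.
  exact: isotropic_orthogonal.
have : line_stab w (transvection v).
  rewrite -e; split; first exact: SU21_transvection.
  by exists 1; rewrite transvectionE iv mulr0 scale0r addr0 scale1r.
move=> [_ [c]]; rewrite transvectionE => h.
have k0 : 'i%C * Qform v w != 0.
  by rewrite mulf_neq0 // eq_complex /= oner_eq0 andbF.
have vE : v = (('i%C * Qform v w)^-1 * (c - 1)) *: w.
  rewrite -scalerA scalerBl scale1r -h addrAC subrr add0r.
  by rewrite scalerA mulVf // scale1r.
exists (('i%C * Qform v w)^-1 * (c - 1)) => //.
by apply: contra v0 => /eqP c0; rewrite vE c0 scale0r.
Qed.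
End Par.

(** * Heights of lattice vectors, and the sets E and D in coordinates *)

Section Exh.
Variable R : realType.
Implicit Types (u v w : 'cV[R[i]]_3) (c : R[i]) (y r : R) (beta : R[i]).

Lemma gaussianD (x y : R[i]) : gaussian x -> gaussian y -> gaussian (x + y).
Proof.
by case: x y => a b [c d] [/= ? ?] [/= ? ?]; split; rewrite /= rpredD.
Qed.

Lemma gaussianM (x y : R[i]) : gaussian x -> gaussian y -> gaussian (x * y).
Proof.
case: x y => a b [c d] [/= ? ?] [/= ? ?].
by split; rewrite /= ?rpredD ?rpredN ?rpredM.
Qed.

Lemma int_ge1 (x : R) : x \is a Num.int -> 0 < x -> 1 <= x.
Proof. by move=> /intrP[n ->]; rewrite ltr0z ler1z. Qed.

Lemma gaussian_normc_ge1 (x : R[i]) : gaussian x -> x != 0 -> 1 <= normc x ^+ 2.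
Proof.
move=> [i1 i2] x0; rewrite sqr_normc; apply: int_ge1.
  by rewrite rpredD ?rpredX.
rewrite lt_def addr_ge0 ?sqr_ge0 // andbT paddr_eq0 ?sqr_ge0 // !expf_eq0 /=.
by move: x0; rewrite eq_complex.
Qed.

Lemma gaussian_dot (a : 'rV[R[i]]_3) v :
  (forall k, gaussian (a 0 k)) -> (forall k, gaussian (v k 0)) ->
  gaussian ((a *m v) 0 0).
Proof.
by move=> ga gv; rewrite mulmx3E; do 2?apply: gaussianD; apply: gaussianM.
Qed.

Lemma reduced_neq0 v : reduced v -> v != 0.
Proof.
move=> [_ [a [_ av]]]; apply/eqP => v0; move: av; rewrite v0 mulmx0 mxE => /eqP.
by rewrite eq_sym oner_eq0.
Qed.

(** The Bezout relations exhibit c and an inverse d of c as Gaussian integers; both have modulus at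
    least 1, and their product is 1. *)
Lemma reduced_scale v w c : reduced v -> reduced w -> v = c *: w -> normc c = 1.
Proof.
move=> [gv [a [ga av]]] [gw [b [gb bw]]] e.
have c1 : 1 = c * (a *m w) 0 0 by rewrite -av e -scalemxAr mxE.
have gc : gaussian c.
  have -> : c = (b *m v) 0 0 by rewrite e -scalemxAr mxE bw mulr1.
  exact: gaussian_dot.
have gd := gaussian_dot ga gw; move: (_ 0 0) gd c1 => d gd cd.
have c0 : c != 0.
  by apply: contra_eq_neq cd => ->; rewrite mul0r oner_eq0.
have d0 : d != 0.
  by apply: contra_eq_neq cd => ->; rewrite mulr0 oner_eq0.
have n1 := gaussian_normc_ge1 gc c0; have n2 := gaussian_normc_ge1 gd d0.
have : normc c ^+ 2 * normc d ^+ 2 = 1.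
  rewrite -exprMn -ComplexField.Normc.normcM -cd.
  by rewrite ComplexField.Normc.normc1 expr1n.
have nc : 0 <= normc c by case: (c) => ? ?; exact: sqrtr_ge0.
move=> h; apply/eqP; rewrite -(@eqrXn2 _ 2) // expr1n; apply/eqP; nra.
Qed.

(* On isotropic vectors the quadratic expression defining [exhaust_vec] is the
   squared modulus of this linear form. *)
Definition linform v (y : R) beta (r : R) : R[i] :=
  v 0 0 - beta * v 1 0 + ((- r) +i* (normc beta ^+ 2 / 2 + y ^+ 2))%C * v 2 0.

Definition height v y beta r : R := normc (linform v y beta r) ^+ 2.

Lemma exhaust_vec_denom v y beta r : isotropic v ->
  normc (v 0 0 - beta * v 1 0
         + ((- r) +i* (normc beta ^+ 2 / 2))%C * v 2 0) ^+ 2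
     + y ^+ 2 * normc (v 1 0 - 'i%C * beta^*%C * v 2 0) ^+ 2
     + y ^+ 4 * normc (v 2 0) ^+ 2 = height v y beta r.
Proof.
move=> /isotropicE; rewrite /height /linform !sqr_normc.
case: beta => g h; case: (v 0 0) (v 1 0) (v 2 0) => [a b] [c d] [e f] /= iso.
(* The two sides differ by y^2 times the isotropy relation. *)
by have := congr1 ( *%R (y ^+ 2)) iso; rewrite /=; lra.
Qed.

Lemma vec3E (n p q : R[i]) :
  [/\ vec3 n p q 0 0 = n, vec3 n p q 1 0 = p & vec3 n p q 2 0 = q].
Proof. by rewrite !mxE. Qed.

Lemma height_infty y beta r : height (vec3 1 0 0) y beta r = 1.
Proof.
have [e0 e1 e2] := vec3E 1 0 0; rewrite /height /linform e0 e1 e2.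
by rewrite !mulr0 subr0 addr0 ComplexField.Normc.normc1 expr1n.
Qed.

Lemma height_gt0 v y beta r : 0 < y -> isotropic v -> v != 0 ->
  0 < height v y beta r.
Proof.
move=> y0 iv v0; have y2 : 0 < y ^+ 2 by rewrite exprn_gt0.
have y4 : 0 < y ^+ 4 by rewrite exprn_gt0.
rewrite lt_def sqr_ge0 andbT -exhaust_vec_denom //.
have n2 (a : R) : 0 <= y ^+ 2 * a ^+ 2 by rewrite mulr_ge0 ?sqr_ge0 ?ltW.
have n4 (a : R) : 0 <= y ^+ 4 * a ^+ 2 by rewrite mulr_ge0 ?sqr_ge0 ?ltW.
rewrite !paddr_eq0 ?addr_ge0 ?n2 ?n4 ?sqr_ge0 //.
have m2 (a : R) : (y ^+ 2 * a ^+ 2 == 0) = (a == 0).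
  by rewrite mulf_eq0 (gt_eqF y2) sqrf_eq0.
have m4 (a : R) : (y ^+ 4 * a ^+ 2 == 0) = (a == 0).
  by rewrite mulf_eq0 (gt_eqF y4) sqrf_eq0.
rewrite sqrf_eq0 m2 m4.
apply: contra v0 => /andP[/andP[/eqP/ComplexField.Normc.eq0_normc e0
  /eqP/ComplexField.Normc.eq0_normc e1] /eqP/ComplexField.Normc.eq0_normc e2].
move: e0 e1; rewrite e2 !mulr0 subr0 addr0 => e0 e1.
move: e0; rewrite e1 mulr0 subr0.
by move=> e0; apply/eqP; apply: cV3_eq; rewrite mxE.
Qed.

Lemma exhaust_vecE v y beta r : isotropic v ->
  exhaust_vec v y beta r = y / Num.sqrt (height v y beta r).
Proof. by move=> iv; rewrite /exhaust_vec exhaust_vec_denom. Qed.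

Lemma height_scale c v y beta r :
  height (c *: v) y beta r = normc c ^+ 2 * height v y beta r.
Proof.
rewrite /height -exprMn -ComplexField.Normc.normcM; congr (normc _ ^+ 2).
by rewrite /linform !mxE; ring.
Qed.

Lemma symspace_pt y beta r : 0 < y -> symspace (pt y beta r).
Proof. by move=> y0; exists (iwasawa y beta r) => //; exact: SU21_iwasawa. Qed.

Lemma symspaceP (z : set 'M[R[i]]_3) : symspace z ->
  exists y beta r, 0 < y /\ z = pt y beta r.
Proof. by move=> [g sg <-]; exact: iwasawa_exists. Qed.

Lemma coords_pt y beta r : 0 < y -> coords (pt y beta r) = (y, beta, r).
Proof.
move=> y0; rewrite /coords; set A := (X in xget _ X).
have : A (xget (1, 0, 0) A) by apply: (@xgetPex _ _ A); exists (y, beta, r).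
case: (xget _ _) => -[y' b'] r' [/= y'0 e].
by have [-> -> ->] := pt_inj y0 y'0 e.
Qed.

(** [pvec] may choose another reduced vector than v on the same line; the two differ by a scalar of
    modulus 1, which the height ignores. *)
Lemma exhaust_line_stab v y beta r : 0 < y -> isotropic v -> reduced v ->
  exhaust (line_stab v) (pt y beta r) = y / Num.sqrt (height v y beta r).
Proof.
move=> y0 iv rv; rewrite /exhaust coords_pt //.
have : [set w | [/\ isotropic w, reduced w & line_stab v = line_stab w]]
    (pvec (line_stab v)) by apply: xgetPex; exists v.
move: (pvec _) => w [iw rw e]; rewrite exhaust_vecE //.
have [c c0 vE] := line_stab_inj iv iw (reduced_neq0 rv) (reduced_neq0 rw) e.
by rewrite vE height_scale (reduced_scale rv rw vE) expr1n mul1r.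
Qed.

Lemma le_exhaust v w y beta r : 0 < y -> isotropic v -> reduced v ->
  isotropic w -> reduced w ->
  (exhaust (line_stab w) (pt y beta r) <= exhaust (line_stab v) (pt y beta r))
  = (height v y beta r <= height w y beta r).
Proof.
move=> y0 iv rv iw rw; rewrite !exhaust_line_stab // ler_pM2l //.
have hv := height_gt0 beta r y0 iv (reduced_neq0 rv).
have hw := height_gt0 beta r y0 iw (reduced_neq0 rw).
by rewrite lef_pV2 ?posrE ?sqrtr_gt0 // ler_sqrt // ltW.
Qed.

(* The vector (1, 0, 0) belongs to every family J and has height 1, so all
   first-contact conditions compare heights with 1. *)
Definition minimal y beta r : Prop :=
  forall w, isotropic w -> reduced w -> 1 <= height w y beta r.

Lemma mem_assoc_parab (J : seq 'cV[R[i]]_3) v : v \in J ->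
  assoc_parab J (line_stab v).
Proof. by exists v. Qed.

Lemma E_pt (J : seq 'cV[R[i]]_3) y beta r : 0 < y ->
  (forall v, v \in J -> isotropic v /\ reduced v) -> vec3 1 0 0 \in J ->
  E (assoc_parab J) (pt y beta r) <->
  forall v, v \in J -> height v y beta r = 1.
Proof.
move=> y0 JP J1; split=> [[_ h] v vJ|h].
  have [iv rv] := JP v vJ; have [i1 r1] := JP _ J1.
  have e := h _ _ (mem_assoc_parab vJ) (mem_assoc_parab J1).
  apply: le_anti; rewrite -[1](height_infty y beta r).
  by rewrite -!le_exhaust // e lexx.
split; first exact: symspace_pt.
move=> _ _ [v vJ <-] [w wJ <-].
have [iv rv] := JP v vJ; have [iw rw] := JP w wJ.
by rewrite !exhaust_line_stab // !h.
Qed.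

(** Dominance of (1, 0, 0) is exactly minimality. Any other v in J has height at least 1 by
    minimality, and at most 1 because it dominates (1, 0, 0). *)
Lemma D_pt (J : seq 'cV[R[i]]_3) y beta r : 0 < y ->
  (forall v, v \in J -> isotropic v /\ reduced v) -> vec3 1 0 0 \in J ->
  D (assoc_parab J) (pt y beta r) <->
  minimal y beta r /\ forall v, v \in J -> height v y beta r = 1.
Proof.
move=> y0 JP J1.
have D1P v : isotropic v -> reduced v -> D1 (line_stab v) (pt y beta r) <->
    forall w, isotropic w -> reduced w ->
      height v y beta r <= height w y beta r.
  move=> iv rv; split=> [[_ h] w iw rw|h].
    rewrite -le_exhaust //.
    (* [D1] does not compare a parabolic with itself, but different vectors can define the same
       one. *)
    have [->//|/eqP ne] := eqVneq (line_stab w) (line_stab v).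
    by apply: h => //; exists w.
  split; first exact: symspace_pt.
  by move=> _ [w [iw rw] <-] _; rewrite le_exhaust //; exact: h.
split=> [h|[h1 h2] _ [v vJ <-]].
  have min : minimal y beta r.
    move=> w iw rw; rewrite -(height_infty y beta r).
    have [i1 r1] := JP _ J1.
    exact: (D1P _ i1 r1).1 (h _ (mem_assoc_parab J1)) w iw rw.
  split=> // v vJ; have [iv rv] := JP v vJ; have [i1 r1] := JP _ J1.
  apply: le_anti; rewrite min // andbT -[1](height_infty y beta r).
  exact: (D1P _ iv rv).1 (h _ (mem_assoc_parab vJ)) _ i1 r1.
have [iv rv] := JP v vJ; apply/D1P => // w iw rw.
by rewrite h2 //; exact: h1.
Qed.

Lemma locus_pt (A : R -> R[i] -> R -> Prop) y beta r : 0 < y ->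
  locus A (pt y beta r) <-> A y beta r.
Proof.
move=> y0; split=> [[y' [b' [r' [y'0 e h]]]]|h]; last by exists y, beta, r.
by have [-> -> ->] := pt_inj y0 y'0 e.
Qed.

Lemma locus_symspace (A : R -> R[i] -> R -> Prop) : locus A `<=` @symspace R.
Proof. by move=> z [y [b [r [y0 -> _]]]]; exact: symspace_pt. Qed.

Lemma D_symspace (J : seq 'cV[R[i]]_3) : vec3 1 0 0 \in J ->
  D (assoc_parab J) `<=` @symspace R.
Proof. by move=> J1 z h; have [] := h _ (mem_assoc_parab J1). Qed.

Lemma eq_symspace (A B : set (set 'M[R[i]]_3)) :
  A `<=` @symspace R -> B `<=` @symspace R ->
  (forall y beta r, 0 < y -> A (pt y beta r) <-> B (pt y beta r)) -> A = B.
Proof.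
move=> sA sB AB; rewrite eqEsubset; split=> z hz.
  have [y [b [r [y0 e]]]] := symspaceP (sA z hz).
  by move: hz; rewrite e => /(AB _ _ _ y0).
have [y [b [r [y0 e]]]] := symspaceP (sB z hz).
by move: hz; rewrite e => /(AB _ _ _ y0).
Qed.
End Exh.

(** * The lower bound on y *)

Section Oct.
Variable R : realFieldType.

(* The bound is the value of X^2 + Z^2 = 4 (1 - s^2) - 4 (1 + s^2) y^2 at
   y^2 = 9/20, which is slightly larger than 1 / sqrt 5; s <= 27/100 comes
   from |r| <= 1/2. *)
Lemma octant_bound (X Z s : R) : 0 <= s <= 27 / 100 -> 0 <= X <= Z ->
  X ^+ 2 + Z ^+ 2 < 4 -> 1 + s ^+ 2 <= X ^+ 2 + (Z - 2) ^+ 2 ->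
  1 + s ^+ 2 <= (X - 1) ^+ 2 + (Z - 2 + s) ^+ 2 ->
  X ^+ 2 + Z ^+ 2 < 11 / 5 - 29 / 5 * s ^+ 2.
Proof.
move=> /andP[s0 s1] /andP[X0 XZ] T4 Q P.
rewrite ltNge; apply/negP => L.
pose d := 2 - Z; have Zd : Z = 2 - d by rewrite /d; ring.
rewrite Zd in XZ T4 Q P L.
have d0 : 0 < d by nra.
have d2 : d <= 2 by lra.
have s2 : s ^+ 2 <= 27 / 100 * s by nra.
have [X1|X1] := leP 1 X.
  (* [P] reads X (2 - X) <= d^2 - 2 d s, and X <= Z is d <= 2 - X. The conclusion leaves only X = d
     = 1 and s = 0, contrary to [L]. *)
  have h : X + 2 * s <= d.
    rewrite -(ler_pM2r d0); nra.
  by nra.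
have [Xh|Xh] := leP X (1 / 2).
  (* The constant lies just below sqrt 3 / 2, the bound that [Q] gives at X = 1/2 and s = 0. *)
  have h : 173 / 200 <= d.
    by rewrite leNgt; apply/negP => h; nra.
  nra.
(* A line replaces the circle of [P]: it gives (d - s)^2 >= X (2 - X), and this is at least ((1 + X)
   / 2)^2 for 1/5 <= X <= 1. *)
have h : (1 + X) / 2 + s <= d.
  rewrite leNgt; apply/negP => h.
  have [ds|ds] := leP 0 (d - s); last by nra.
  have : (d - s) ^+ 2 < ((1 + X) / 2) ^+ 2 by nra.
  nra.
nra.
Qed.
End Oct.

(** * Inequalities that minimality imposes through explicit lattice vectors *)

Section Min.
Variable R : realType.
Implicit Types (v w : 'cV[R[i]]_3) (y b c r t : R) (beta : R[i]).

Lemma heightE v y b c r :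
  let t := (b ^+ 2 + c ^+ 2) / 2 + y ^+ 2 in
  height v y (b +i* c)%C r =
    (complex.Re (v 0 0) - (b * complex.Re (v 1 0) - c * complex.Im (v 1 0))
      - r * complex.Re (v 2 0) - t * complex.Im (v 2 0)) ^+ 2
    + (complex.Im (v 0 0) - (b * complex.Im (v 1 0) + c * complex.Re (v 1 0))
      - r * complex.Im (v 2 0) + t * complex.Re (v 2 0)) ^+ 2.
Proof.
rewrite /height /linform !sqr_normc.
by case: (v 0 0) (v 1 0) (v 2 0) => [n1 n2] [p1 p2] [q1 q2] /=; ring.
Qed.

Lemma isotropic_vec3 (n p q : R[i]) :
  complex.Re p ^+ 2 + complex.Im p ^+ 2
    = 2 * (complex.Im n * complex.Re q - complex.Re n * complex.Im q) ->
  isotropic (vec3 n p q).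
Proof.
move=> h; apply/isotropicE; have [-> -> ->] := vec3E n p q.
rewrite sqr_normc h; case: n q {h} => a b [c d] /=; ring.
Qed.

Lemma reduced_vec3 (n p q : R[i]) : gaussian n -> gaussian p -> gaussian q ->
  normc n ^+ 2 = 1 \/ normc q ^+ 2 = 1 -> reduced (vec3 n p q).
Proof.
move=> gn gp gq u; have [e0 e1 e2] := vec3E n p q.
have conjE (z : R[i]) : normc z ^+ 2 = 1 -> z^*%C * z = 1.
  rewrite sqr_normc; case: z => a b /= h.
  by apply: eq_complexP => /=; [rewrite -h|]; ring.
have gconj (z : R[i]) : gaussian z -> gaussian z^*%C.
  by case: z => a b [h1 h2]; split; rewrite //= rpredN.
have g0 : gaussian (0 : R[i]) by split; rewrite /= rpred0.
split; first by elim/ord3_ind; rewrite ?e0 ?e1 ?e2.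
case: u => u.
  exists (\row_j if j == 0 then n^*%C else 0); split.
    by move=> k; rewrite mxE; case: eqP => _; [exact: gconj|].
  by rewrite mulmx3E !mxE /= !mul0r !addr0 conjE.
exists (\row_j if j == 2 then q^*%C else 0); split.
  by move=> k; rewrite mxE; case: eqP => _; [exact: gconj|].
by rewrite mulmx3E !mxE /= !mul0r !add0r conjE.
Qed.

(** Apart from |beta|, the height sees beta only through beta p, so the rotation is absorbed by p ->
    i p, which preserves isotropic and reduced vectors. *)
Lemma minimal_rot y beta r : minimal y beta r -> minimal y ('i%C * beta) r.
Proof.
move=> min w iw rw; pose w' := vec3 (w 0 0) ('i%C * w 1 0) (w 2 0).
have [e0 e1 e2] := vec3E (w 0 0) ('i%C * w 1 0) (w 2 0).
have -> : height w y ('i%C * beta) r = height w' y beta r.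
  rewrite /height /linform e0 e1 e2 ComplexField.Normc.normcM.
  have -> : normc 'i%C = 1 :> R by rewrite /= expr0n expr1n add0r sqrtr1.
  by rewrite mul1r; congr (normc _ ^+ 2); ring.
have i2 : 'i%C * 'i%C = -1 :> R[i] by rewrite -expr2 sqr_i.
apply: min.
  apply/isotropicE; rewrite e0 e1 e2; move/isotropicE: iw => <-.
  rewrite ComplexField.Normc.normcM.
  have -> : normc 'i%C = 1 :> R by rewrite /= expr0n expr1n add0r sqrtr1.
  by rewrite mul1r.
case: rw => gw [a [ga aw]].
have gi : gaussian ('i%C : R[i]) by split; rewrite /= ?rpred0 ?rpred1.
have gmi : gaussian (- 'i%C : R[i]).
  by split; rewrite /= ?oppr0 ?rpred0 // rpredN rpred1.
split; first by elim/ord3_ind; rewrite ?e0 ?e1 ?e2 //; exact: gaussianM.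
exists (\row_j if j == 1 then - 'i%C * a 0 1 else a 0 j); split.
  by move=> k; rewrite mxE; case: eqP => _ //; exact: gaussianM.
rewrite mulmx3E !mxE /= -aw mulmx3E.
by rewrite (mulrC (- _)) mulrA -(mulrA (a 0 1)) mulNr i2 opprK mulr1.
Qed.

(** With integer parameters, isotropy and the presence of a unit entry hold by computation for
    concrete vectors. *)
Lemma minimal_le y b c r (n1 n2 p1 p2 q1 q2 : int) :
  let t := (b ^+ 2 + c ^+ 2) / 2 + y ^+ 2 in
  minimal y (b +i* c)%C r ->
  p1 ^+ 2 + p2 ^+ 2 = 2 * (n2 * q1 - n1 * q2) ->
  n1 ^+ 2 + n2 ^+ 2 = 1 \/ q1 ^+ 2 + q2 ^+ 2 = 1 ->
  1 <= (n1%:~R - (b * p1%:~R - c * p2%:~R) - r * q1%:~R - t * q2%:~R) ^+ 2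
     + (n2%:~R - (b * p2%:~R + c * p1%:~R) - r * q2%:~R + t * q1%:~R) ^+ 2.
Proof.
move=> t min iso u; pose v := vec3 (n1%:~R +i* n2%:~R : R[i])%C
  (p1%:~R +i* p2%:~R)%C (q1%:~R +i* q2%:~R)%C.
have g (m k : int) : gaussian (m%:~R +i* k%:~R : R[i])%C.
  by split; rewrite /= intr_int.
have nu (m k : int) : m ^+ 2 + k ^+ 2 = 1 ->
    normc (m%:~R +i* k%:~R : R[i])%C ^+ 2 = 1.
  by move=> e; rewrite sqr_normc /= -!rmorphXn -rmorphD /= e.
have := min v; rewrite heightE.
have [-> -> ->] := vec3E (n1%:~R +i* n2%:~R : R[i])%C
  (p1%:~R +i* p2%:~R)%C (q1%:~R +i* q2%:~R)%C.
apply; last by apply: reduced_vec3 => //; case: u => /nu; [left|right].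
apply: isotropic_vec3 => /=; have := congr1 (fun m : int => m%:~R : R) iso.
by rewrite /= !(rmorphD, rmorphM, rmorphXn, rmorphN).
Qed.

(** On r^2 + t^2 = 1 the vectors (1, 0, 1) and (-1, 0, 1) have heights 2 - 2 r and 2 + 2 r. *)
Lemma minimal_half y b c r : minimal y (b +i* c)%C r ->
  r ^+ 2 + ((b ^+ 2 + c ^+ 2) / 2 + y ^+ 2) ^+ 2 = 1 -> - (1 / 2) <= r <= 1 / 2.
Proof.
move=> min e.
have := @minimal_le y b c r 1 0 0 0 1 0 min erefl (or_introl erefl).
have := @minimal_le y b c r (-1) 0 0 0 1 0 min erefl (or_introl erefl).
rewrite !(mulrN1z, mulr0z, mulr1z); move: e.
set t := (_ + y ^+ 2) => e h1 h2; lra.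
Qed.

(* Here s = tan (phi / 2) where (-r + i tau) = i exp (i phi), and
   X + i Z = (1 + i) (1 - i s) beta. *)
Definition discs (s X Z : R) : Prop :=
  1 + s ^+ 2 <= X ^+ 2 + (Z - 2) ^+ 2 /\
  [/\ 1 + s ^+ 2 <= (X - 1) ^+ 2 + (Z - 2 + s) ^+ 2,
      1 + s ^+ 2 <= (X - 1) ^+ 2 + (Z - 2 - s) ^+ 2,
      1 + s ^+ 2 <= (X + 1) ^+ 2 + (Z - 2 + s) ^+ 2 &
      1 + s ^+ 2 <= (X + 1) ^+ 2 + (Z - 2 - s) ^+ 2].

(** Multiplied by 1 + s^2, the heights become squared distances in the (X, Z) plane. The vector (i,
    1 + i, 1) gives the centre (0, 2); adding 1 or -1 to n moves it by (1, -s) or its negative, and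
    subtracting or adding i at q moves it by (1, s) or its negative. *)
Lemma minimal_discs y b c r s :
  minimal y (b +i* c)%C r -> r * (1 + s ^+ 2) = 2 * s ->
  ((b ^+ 2 + c ^+ 2) / 2 + y ^+ 2) * (1 + s ^+ 2) = 1 - s ^+ 2 ->
  discs s (b - c + s * (b + c)) (b + c + s * (c - b)).
Proof.
move=> min.
have := @minimal_le y b c r 0 1 1 1 1 0 min erefl (or_intror erefl).
have := @minimal_le y b c r 1 1 1 1 1 0 min erefl (or_intror erefl).
have := @minimal_le y b c r (-1) 1 1 1 1 0 min erefl (or_intror erefl).
have := @minimal_le y b c r 0 1 1 1 1 1 min erefl (or_introl erefl).
have := @minimal_le y b c r 0 1 1 1 1 (-1) min erefl (or_introl erefl).
rewrite !(mulrN1z, mulr0z, mulr1z); set t := (_ + y ^+ 2).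
have k0 : 0 < 1 + s ^+ 2 by rewrite ltr_pwDl // sqr_ge0.
move=> h1 h2 h3 h4 h5 er et.
have {}er : r = 2 * s / (1 + s ^+ 2) by rewrite -er mulfK // gt_eqF.
have {}et : t = (1 - s ^+ 2) / (1 + s ^+ 2) by rewrite -et mulfK // gt_eqF.
move: h1 h2 h3 h4 h5; rewrite er et => {t er et min} h1 h2 h3 h4 h5.
have kn : 1 + s ^+ 2 != 0 by rewrite gt_eqF.
have up (u v : R) : v = (1 + s ^+ 2) * u -> 1 <= u -> 1 + s ^+ 2 <= v.
  by move=> -> u1; rewrite ler_peMr // ltW.
split; first by apply: up h5; field.
split.
- by apply: up h4; field.
- by apply: up h1; field.
- by apply: up h2; field.
- by apply: up h3; field.
Qed.
End Min.

(** * Symmetry reductions and the covering argument *)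

Section Bound.
Variable R : realType.
Implicit Types (y b c r t s X Z : R).

Lemma discs_bound s X Z : discs s X Z -> `|s| <= 27 / 100 -> `|X| <= Z ->
  X ^+ 2 + Z ^+ 2 < 4 -> X ^+ 2 + Z ^+ 2 < 11 / 5 - 29 / 5 * s ^+ 2.
Proof.
move=> [h0 [h1 h2 h3 h4]] s1 XZ T4.
have sE : `|s| ^+ 2 = s ^+ 2 by rewrite real_normK ?num_real.
have XE : `|X| ^+ 2 = X ^+ 2 by rewrite real_normK ?num_real.
rewrite -XE -sE; apply: octant_bound; rewrite ?normr_ge0 ?XE ?sE //.
have X1 : - X - 1 = - (X + 1) by ring.
by case: (ger0P X) => _; case: (ger0P s) => _; rewrite ?X1 ?sqrrN.
Qed.

(** Multiplying beta by i rotates (X, Z) by a right angle. *)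
Lemma minimal_discs4 y b c r s (X := b - c + s * (b + c))
    (Z := b + c + s * (c - b)) :
  minimal y (b +i* c)%C r -> r * (1 + s ^+ 2) = 2 * s ->
  ((b ^+ 2 + c ^+ 2) / 2 + y ^+ 2) * (1 + s ^+ 2) = 1 - s ^+ 2 ->
  [/\ discs s X Z, discs s (- Z) X, discs s (- X) (- Z) & discs s Z (- X)].
Proof.
move=> min er et.
have rot (b' c' : R) : minimal y (b' +i* c')%C r -> minimal y (- c' +i* b')%C r.
  move=> /minimal_rot; congr (minimal _ _ _); apply: eq_complexP => /=; ring.
have min1 := rot _ _ min; have min2 := rot _ _ min1; have min3 := rot _ _ min2.
split; first exact: minimal_discs min er et.
- have -> : - Z = - c - b + s * (- c + b) by rewrite /Z; ring.
  have -> : X = - c + b + s * (b - - c) by rewrite /X; ring.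
  by apply: minimal_discs min1 er _; rewrite sqrrN (addrC (c ^+ 2)).
- have -> : - X = - b - - c + s * (- b + - c) by rewrite /X; ring.
  have -> : - Z = - b + - c + s * (- c - - b) by rewrite /Z; ring.
  by apply: minimal_discs min2 er _; rewrite !sqrrN.
- have -> : Z = - - c - - b + s * (- - c + - b) by rewrite /Z; ring.
  have -> : - X = - - c + - b + s * (- b - - - c) by rewrite /X; ring.
  by apply: minimal_discs min3 er _; rewrite !sqrrN (addrC (c ^+ 2)).
Qed.

Lemma y2_bound y b c r (t := (b ^+ 2 + c ^+ 2) / 2 + y ^+ 2) : 0 < y ->
  minimal y (b +i* c)%C r -> r ^+ 2 + t ^+ 2 = 1 -> 9 / 20 < y ^+ 2.
Proof.
move=> y0 min e; have y2 : 0 < y ^+ 2 by rewrite exprn_gt0.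
have /andP[r1 r2] := minimal_half min e.
have t0 : 0 < t by rewrite ltr_wpDl // divr_ge0 // addr_ge0 ?sqr_ge0.
(* From |r| <= 1/2 one has t >= sqrt 3 / 2, and 433/500 lies just below that. *)
have t1 : 433 / 500 <= t by rewrite leNgt; apply/negP => h; nra.
pose s := r / (1 + t); have u0 : 1 + t != 0 by rewrite gt_eqF // addr_gt0.
have rE : r = s * (1 + t) by rewrite /s divfK.
have ks : (1 + s ^+ 2) * (1 + t) = 2.
  by apply: (mulIf u0); move: e; rewrite rE; nra.
have er : r * (1 + s ^+ 2) = 2 * s by rewrite rE -ks; ring.
have et : t * (1 + s ^+ 2) = 1 - s ^+ 2 by move: ks; nra.
(* This rounds up (1/2) / (1 + 433/500) = 250/933. *)
have s1 : `|s| <= 27 / 100.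
  have ut : 0 < 1 + t by rewrite addr_gt0.
  by rewrite ler_norml; apply/andP; split; rewrite -(ler_pM2r ut) -rE; lra.
have [d0 d1 d2 d3] := minimal_discs4 min er et.
set X := _ - _ + _ in d0 d1 d2 d3; set Z := _ + _ + _ in d0 d1 d2 d3.
(* Both sides are 2 (1 + s^2) |beta|^2, as |beta|^2 = 2 (t - y^2). *)
have TE : X ^+ 2 + Z ^+ 2 = 4 * (1 - s ^+ 2) - 4 * (1 + s ^+ 2) * y ^+ 2.
  by rewrite -et /X /Z /t; field.
have T4 : X ^+ 2 + Z ^+ 2 < 4.
  rewrite TE; have s2 : 0 <= s ^+ 2 by rewrite sqr_ge0.
  nra.
suff : X ^+ 2 + Z ^+ 2 < 11 / 5 - 29 / 5 * s ^+ 2.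
  rewrite TE => h; rewrite ltNge; apply/negP => h'.
  have s2 : 0 <= s ^+ 2 by rewrite sqr_ge0.
  nra.
have T4' : Z ^+ 2 + X ^+ 2 < 4 by rewrite addrC.
(* The larger of |X| and |Z|, with its sign, selects the rotation that brings the point into the
   cone around the positive Z axis. *)
have [XZ|/ltW ZX] := leP `|X| `|Z|.
  have [Z0|Z0] := ger0P Z.
    by apply: discs_bound d0 s1 _ _; rewrite // -(ger0_norm Z0).
  rewrite -(sqrrN X) -(sqrrN Z); apply: discs_bound d2 s1 _ _.
    by rewrite normrN -(ltr0_norm Z0).
  by rewrite !sqrrN.
rewrite addrC; have [X0|X0] := ger0P X.
  rewrite -(sqrrN Z); apply: discs_bound d1 s1 _ _.
    by rewrite normrN -(ger0_norm X0).
  by rewrite sqrrN.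
rewrite -(sqrrN X); apply: discs_bound d3 s1 _ _.
  by rewrite -(ltr0_norm X0).
by rewrite sqrrN.
Qed.
End Bound.

(** * The contact sets *)

Section Fam.
Variable R : realType.
Implicit Types (y b c r t : R).

Lemma height_vec3 (n p q : R[i]) y b c r :
  let t := (b ^+ 2 + c ^+ 2) / 2 + y ^+ 2 in
  height (vec3 n p q) y (b +i* c)%C r =
    (complex.Re n - (b * complex.Re p - c * complex.Im p)
      - r * complex.Re q - t * complex.Im q) ^+ 2
    + (complex.Im n - (b * complex.Im p + c * complex.Re p)
      - r * complex.Im q + t * complex.Re q) ^+ 2.
Proof. by rewrite heightE; have [-> -> ->] := vec3E n p q. Qed.

Lemma forall_mem_cons (T : eqType) (P : T -> Prop) (a : T) (s : seq T) :
  (forall v, v \in a :: s -> P v) <-> P a /\ forall v, v \in s -> P v.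
Proof.
split=> [h|[h1 h2] v].
  by split=> [|v vs]; apply: h; rewrite inE ?eqxx ?vs ?orbT.
by rewrite inE => /orP[/eqP ->|/h2].
Qed.

Lemma forall_mem_nil (T : eqType) (P : T -> Prop) :
  (forall v, v \in [::] -> P v) <-> True.
Proof. by []. Qed.

Ltac int_entry := split => /=;
  do ?[exact: rpred0 | exact: rpred1 | apply: rpredD | rewrite rpredN
      | apply: rpredM].

Ltac lattice_vector := split; [by apply: isotropic_vec3 => /=; ring |
  apply: reduced_vec3; [int_entry | int_entry | int_entry |
    by first [left; rewrite sqr_normc /=; ring
             | right; rewrite sqr_normc /=; ring]]].

Ltac lattice_vectors :=
  rewrite /J8 /J5 /J42 /J41 /J33 /J32 /J31 /J22 /J21 /cat;
  do ?[apply/forall_mem_cons; split; first by lattice_vector]; by [].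

Lemma J21_lattice : forall v, v \in J21 R -> isotropic v /\ reduced v.
Proof. lattice_vectors. Qed.
Lemma J22_lattice : forall v, v \in J22 R -> isotropic v /\ reduced v.
Proof. lattice_vectors. Qed.
Lemma J31_lattice : forall v, v \in J31 R -> isotropic v /\ reduced v.
Proof. lattice_vectors. Qed.
Lemma J32_lattice : forall v, v \in J32 R -> isotropic v /\ reduced v.
Proof. lattice_vectors. Qed.
Lemma J33_lattice : forall v, v \in J33 R -> isotropic v /\ reduced v.
Proof. lattice_vectors. Qed.
Lemma J41_lattice : forall v, v \in J41 R -> isotropic v /\ reduced v.
Proof. lattice_vectors. Qed.
Lemma J42_lattice : forall v, v \in J42 R -> isotropic v /\ reduced v.
Proof. lattice_vectors. Qed.
Lemma J5_lattice : forall v, v \in J5 R -> isotropic v /\ reduced v.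
Proof. lattice_vectors. Qed.
Lemma J8_lattice : forall v, v \in J8 R -> isotropic v /\ reduced v.
Proof. lattice_vectors. Qed.

(** * Contact conditions at one point as quadratic equations in b, c, r and t *)

Section Point.
Variables (y b c r : R) (t : R).
Hypotheses (y0 : 0 < y) (tE : (b ^+ 2 + c ^+ 2) / 2 + y ^+ 2 = t).

Ltac expand_heights :=
  rewrite /J8 /J5 /J42 /J41 /J33 /J32 /J31 /J22 /J21 /cat;
  rewrite !(propext (forall_mem_cons _ _ _)) (propext (forall_mem_nil _));
  rewrite !height_vec3 tE /=.

Ltac D_equations lattice :=
  rewrite (propext (D_pt _ _ y0 lattice (mem_head _ _)));
  expand_heights;
  let m := fresh in let h := fresh in
  split; (intros [m h]; split; [exact m|];
    clear m; decompose [and] h; repeat split; nra).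

Lemma E_I21_pt : E (I21 R) (pt y (b +i* c)%C r) <-> r ^+ 2 + t ^+ 2 = 1.
Proof.
rewrite (propext (E_pt _ _ y0 J21_lattice (mem_head _ _))); expand_heights.
split=> [[_ [h _]]|h]; repeat split; lra.
Qed.

(** The value 1/2 comes from dividing the linear form of (i, 1 + i, 1 + i) by 1 + i, which leaves (1
    + i) / 2 - beta - r + i t. *)
Lemma E_I22_pt : E (I22 R) (pt y (b +i* c)%C r) <->
  (1 / 2 - b - r) ^+ 2 + (1 / 2 - c + t) ^+ 2 = 1 / 2.
Proof.
rewrite (propext (E_pt _ _ y0 J22_lattice (mem_head _ _))); expand_heights.
split=> [[_ [h _]]|h]; repeat split; lra.
Qed.

Lemma D_I21_pt : D (I21 R) (pt y (b +i* c)%C r) <->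
  minimal y (b +i* c)%C r /\ r ^+ 2 + t ^+ 2 = 1.
Proof. D_equations J21_lattice. Qed.

Lemma D_I22_pt : D (I22 R) (pt y (b +i* c)%C r) <->
  minimal y (b +i* c)%C r /\
  (1 / 2 - b - r) ^+ 2 + (1 / 2 - c + t) ^+ 2 = 1 / 2.
Proof. D_equations J22_lattice. Qed.

Lemma D_I31_pt : D (I31 R) (pt y (b +i* c)%C r) <->
  minimal y (b +i* c)%C r /\ (r ^+ 2 + t ^+ 2 = 1 /\ r = 1 / 2).
Proof. D_equations J31_lattice. Qed.


Lemma D_I32_pt : D (I32 R) (pt y (b +i* c)%C r) <->
  minimal y (b +i* c)%C r /\ (r ^+ 2 + t ^+ 2 = 1 /\
  (b - c + r) ^+ 2 + (1 + t - b - c) ^+ 2 = 1).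
Proof. D_equations J32_lattice. Qed.

Lemma D_I33_pt : D (I33 R) (pt y (b +i* c)%C r) <->
  minimal y (b +i* c)%C r /\ (r ^+ 2 + t ^+ 2 = 1 /\
  (1 - r - b + c) ^+ 2 + (1 + t - b - c) ^+ 2 = 1).
Proof. D_equations J33_lattice. Qed.

Lemma D_I41_pt : D (I41 R) (pt y (b +i* c)%C r) <->
  minimal y (b +i* c)%C r /\ (r ^+ 2 + t ^+ 2 = 1 /\ r = 1 / 2 /\
  (b - c + r) ^+ 2 + (1 + t - b - c) ^+ 2 = 1).
Proof. D_equations J41_lattice. Qed.

Lemma D_I42_pt : D (I42 R) (pt y (b +i* c)%C r) <->
  minimal y (b +i* c)%C r /\ (r ^+ 2 + t ^+ 2 = 1 /\
  (1 - r - b + c) ^+ 2 + (1 + t - b - c) ^+ 2 = 1 /\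
  (c - r - 1 / 2) ^+ 2 + (1 / 2 - b + t) ^+ 2 = 1 / 2).
Proof. D_equations J42_lattice. Qed.

Lemma D_I5_pt : D (I5 R) (pt y (b +i* c)%C r) <->
  minimal y (b +i* c)%C r /\ (r ^+ 2 + t ^+ 2 = 1 /\ r = 1 / 2 /\
  (b - c + r) ^+ 2 + (1 + t - b - c) ^+ 2 = 1 /\
  (1 - r - b + c) ^+ 2 + (1 + t - b - c) ^+ 2 = 1).
Proof. D_equations J5_lattice. Qed.

Lemma D_I8_pt : D (I8 R) (pt y (b +i* c)%C r) <->
  minimal y (b +i* c)%C r /\ (r ^+ 2 + t ^+ 2 = 1 /\
  (1 / 2 + b + r) ^+ 2 + (1 / 2 - c + t) ^+ 2 = 1 / 2 /\
  (1 + b - c + r) ^+ 2 + (1 + t - b - c) ^+ 2 = 1 /\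
  (1 - b - c - r) ^+ 2 + (1 + t + b - c) ^+ 2 = 1 /\
  (1 / 2 - b - r) ^+ 2 + (1 / 2 - c + t) ^+ 2 = 1 / 2 /\
  (2 * b + r) ^+ 2 + (2 + t - 2 * c) ^+ 2 = 1 /\
  (2 * b + 2 * r) ^+ 2 + (1 - 2 * c + 2 * t) ^+ 2 = 1).
Proof. D_equations J8_lattice. Qed.

End Point.
End Fam.

(** * Families of two vectors: equations of E and estimates on D *)

Section Parts.
Variable R : realType.
Implicit Types (y b c r t : R) (beta : R[i]).

(** Positivity of m rules out the default value 0 of the root at negative x. *)
Lemma eq_sqrtr (m x : R) : 0 < m -> m = Num.sqrt x <-> m ^+ 2 = x.
Proof.
move=> m0; split=> [e|<-]; last by rewrite sqrtr_sqr ger0_norm ?ltW.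
rewrite e sqr_sqrtr // leNgt; apply/negP => x0.
by move: m0; rewrite e ltr0_sqrtr ?ltxx.
Qed.

Lemma eq_subsqrtr (m k x : R) : 0 < m + k ->
  m = - k + Num.sqrt x <-> (m + k) ^+ 2 = x.
Proof.
by move=> /eq_sqrtr <-; split=> [->|<-]; ring.
Qed.

Lemma tau_gt0 y b c : 0 < y -> 0 < (b ^+ 2 + c ^+ 2) / 2 + y ^+ 2.
Proof.
by move=> y0; rewrite ltr_wpDl ?exprn_gt0 // divr_ge0 // addr_ge0 ?sqr_ge0.
Qed.

Lemma E_I21_eq : E (I21 R) = locus (fun y beta r =>
     y ^+ 2 = - (normc beta ^+ 2 / 2) + Num.sqrt (1 - r ^+ 2)).
Proof.
apply: eq_symspace; [by move=> ? []|exact: locus_symspace|].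
move=> y [b c] r y0; rewrite (propext (locus_pt _ _ _ y0)) sqr_normc /=.
rewrite (propext (E_I21_pt r y0 erefl)).
have t0 := tau_gt0 b c y0; rewrite addrC in t0.
rewrite (propext (eq_subsqrtr _ t0)); split=> h; lra.
Qed.

Lemma E_I22_eq : E (I22 R) = locus (fun y beta r =>
     y ^+ 2 = - (1 / 2 * normc (1 - 'i%C * beta^*%C) ^+ 2)
              + Num.sqrt (1 / 2 - (1 / 2 - complex.Re beta - r) ^+ 2)).
Proof.
apply: eq_symspace; [by move=> ? []|exact: locus_symspace|].
move=> y [b c] r y0; rewrite (propext (locus_pt _ _ _ y0)) sqr_normc /=.
rewrite (propext (E_I22_pt r y0 erefl)).
rewrite (_ : 1 / 2 * _ = 1 / 2 * ((1 - c) ^+ 2 + b ^+ 2)); last by ring.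
have y2 : 0 < y ^+ 2 by rewrite exprn_gt0.
have c2 : 0 <= (1 - c) ^+ 2 by rewrite sqr_ge0.
have b2 : 0 <= b ^+ 2 by rewrite sqr_ge0.
rewrite (propext (eq_subsqrtr _ _)); last by lra.
rewrite (_ : 1 / 2 - c + _ = y ^+ 2 + 1 / 2 * ((1 - c) ^+ 2 + b ^+ 2));
  last by field.
by split=> h; lra.
Qed.

Lemma D_coords (J : seq 'cV[R[i]]_3) z : vec3 1 0 0 \in J ->
  D (assoc_parab J) z -> exists y b c r, 0 < y /\ z = pt y (b +i* c)%C r.
Proof.
move=> J1 /(D_symspace J1)/symspaceP[y [[b c] [r [y0 ->]]]].
by exists y, b, c, r.
Qed.

Lemma D_I21_sub : D (I21 R) `<=` E (I21 R) `&` locus (fun y beta r =>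
     [/\ 1 / Num.sqrt 5 < y ^+ 2 <= 1,
         - (1 / 2) <= r <= 1 / 2 &
         normc beta ^+ 2 < - (2 / Num.sqrt 5) + 2]).
Proof.
move=> z dz; have [y [b [c [r [y0 zE]]]]] := D_coords (mem_head _ _) dz.
subst z; move: dz; rewrite (propext (D_I21_pt r y0 erefl)) => -[min e].
split; first by rewrite (propext (E_I21_pt r y0 erefl)).
rewrite (propext (locus_pt _ _ _ y0)) sqr_normc /=.
have half := minimal_half min e; have y2 := y2_bound y0 min e.
have t0 := tau_gt0 b c y0; have w5 : 1 / Num.sqrt 5 <= 9 / 20 :> R.
  have s0 : 0 < Num.sqrt 5 :> R by rewrite sqrtr_gt0.
  rewrite ler_pdivrMr //; have : Num.sqrt 5 ^+ 2 = 5 :> R by rewrite sqr_sqrtr.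
  nra.
have b2 : 0 <= b ^+ 2 by rewrite sqr_ge0.
have c2 : 0 <= c ^+ 2 by rewrite sqr_ge0.
(* As y^2 = t - |beta|^2 / 2, this yields y^2 <= 1 and turns the lower bound on y^2 into the upper
   bound on |beta|^2. *)
have t1 : (b ^+ 2 + c ^+ 2) / 2 + y ^+ 2 <= 1.
  move: t0 e; set t := (_ + y ^+ 2) => t0 e; rewrite leNgt; apply/negP => t1.
  have r2 : 0 <= r ^+ 2 by rewrite sqr_ge0.
  nra.
split=> //; first by apply/andP; split; lra.
lra.
Qed.

Lemma D_I22_sub : D (I22 R) `<=` E (I22 R) `&` locus (fun y beta r =>
     0 <= complex.Re beta + r < Num.sqrt (3 / 10) + 1 / 2).
Proof.
move=> z dz; have [y [b [c [r [y0 zE]]]]] := D_coords (mem_head _ _) dz.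
subst z; move: dz; rewrite (propext (D_I22_pt r y0 erefl)) => -[min e].
split; first by rewrite (propext (E_I22_pt r y0 erefl)).
rewrite (propext (locus_pt _ _ _ y0)) /=.
(* After division by 1 + i, this vector and (1 + 2 i, 1 + i, 1 + i) below replace 1/2 - b - r in the
   contact equation by its translates by -1 and 1, whence 0 <= b + r <= 1. *)
have := @minimal_le R y b c r (-1) 0 1 1 1 1 min erefl (or_introl erefl).
rewrite !(mulrN1z, mulr0z, mulr1z) => h.
have br : 0 <= b + r by lra.
have [e0 e1 e2] := vec3E (1 +i* 2)%C (1 +i* 1)%C (1 +i* 1 : R[i])%C.
have iv : isotropic (vec3 (1 +i* 2)%C (1 +i* 1)%C (1 +i* 1 : R[i])%C).
  by apply: isotropic_vec3 => /=; ring.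
have rv : reduced (vec3 (1 +i* 2)%C (1 +i* 1)%C (1 +i* 1 : R[i])%C).
  have g (x : R[i]) : complex.Re x \is a Num.int ->
    complex.Im x \is a Num.int -> gaussian x by [].
  split.
    by elim/ord3_ind; rewrite ?e0 ?e1 ?e2; apply: g;
      rewrite /= ?rpred1 ?rpred_nat.
  (* No entry is a unit; the Bezout relation is -i (1 + 2 i) + i (1 + i) = 1. *)
  exists (\row_j nth 0 [:: 0 -i* 1; 0 +i* 1; 0]%C j); split.
    by elim/ord3_ind; rewrite mxE; apply: g; rewrite /= ?rpredN ?rpred1 ?rpred0.
  rewrite mulmx3E !mxE /=; apply: eq_complexP => /=; ring.
have h' := min _ iv rv; rewrite height_vec3 /= in h'.
have br1 : b + r <= 1 by lra.
rewrite br /= -ltrBlDr; have [neg|pos] := ltP (b + r - 1 / 2) 0.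
  by rewrite (lt_le_trans neg) // sqrtr_ge0.
(* Here (b + r - 1/2)^2 <= 1/4 < 3/10. *)
rewrite -(@ltr_pXn2r _ 2) ?nnegrE ?sqrtr_ge0 // sqr_sqrtr; last by lra.
nra.
Qed.

End Parts.

(** * Families of three and four vectors *)

Section Parts2.
Variable R : realType.
Implicit Types (y b c r t : R) (beta : R[i]).

Lemma D_cut (J : seq 'cV[R[i]]_3) (A : R -> R[i] -> R -> Prop) :
  vec3 1 0 0 \in J ->
  (forall y b c r, 0 < y -> D (assoc_parab J) (pt y (b +i* c)%C r) <->
     D (I21 R) (pt y (b +i* c)%C r) /\ A y (b +i* c)%C r) ->
  D (assoc_parab J) = D (I21 R) `&` locus A.
Proof.
move=> J1 h; apply: eq_symspace; first exact: D_symspace.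
  by apply: subIset; right; exact: locus_symspace.
move=> y [b c] r y0; rewrite /setI /= (propext (locus_pt _ _ _ y0)); exact: h.
Qed.

Lemma D_I31_eq : D (I31 R) = D (I21 R) `&` locus (fun y beta r => r = 1 / 2).
Proof.
apply: D_cut (mem_head _ _) _ => y b c r y0.
rewrite (propext (D_I31_pt r y0 erefl)) (propext (D_I21_pt r y0 erefl)); tauto.
Qed.

(** The vectors (i, 1 + i, 1) and (1 + i, 1 + i, 1) share the imaginary part 1 + t - b - c of their
    linear form. Completing squares shows it to be y^2 plus half the squared modulus in the
    equation, hence positive, so the root can be extracted. *)
Lemma arc_eq y b c (x : R) : 0 < y ->
  (y ^+ 2 = - (1 / 2 * normc (1 + 'i%C - 'i%C * (b +i* c)^*%C)%C ^+ 2)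
            + Num.sqrt (1 - x ^+ 2))
  <-> (1 + ((b ^+ 2 + c ^+ 2) / 2 + y ^+ 2) - b - c) ^+ 2 = 1 - x ^+ 2.
Proof.
move=> y0; rewrite sqr_normc /=.
rewrite (_ : 1 / 2 * _ = 1 / 2 * ((1 - c) ^+ 2 + (1 - b) ^+ 2)); last by ring.
have y2 : 0 < y ^+ 2 by rewrite exprn_gt0.
have c2 : 0 <= (1 - c) ^+ 2 by rewrite sqr_ge0.
have b2 : 0 <= (1 - b) ^+ 2 by rewrite sqr_ge0.
rewrite (propext (eq_subsqrtr _ _)); last by lra.
rewrite (_ : 1 + _ - b - c =
  y ^+ 2 + 1 / 2 * ((1 - c) ^+ 2 + (1 - b) ^+ 2)); last by field.
by split.
Qed.

Lemma D_I32_eq : D (I32 R) = D (I21 R) `&` locus (fun y beta r =>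
     y ^+ 2 = - (1 / 2 * normc (1 + 'i%C - 'i%C * beta^*%C) ^+ 2)
              + Num.sqrt (1 - (complex.Re (beta * (1 + 'i%C)) + r) ^+ 2)).
Proof.
apply: D_cut (mem_head _ _) _ => y b c r y0.
rewrite (propext (D_I32_pt r y0 erefl)) (propext (D_I21_pt r y0 erefl)).
rewrite (propext (arc_eq _ _ _ y0)) /=.
rewrite (_ : b * (1 + 0) - c * (0 + 1) + r = b - c + r); last by ring.
split=> [[m [e f]]|[[m e] f]]; split=> //; last split=> //; lra.
Qed.

Lemma D_I33_eq : D (I33 R) = D (I21 R) `&` locus (fun y beta r =>
     y ^+ 2 = - (1 / 2 * normc (1 + 'i%C - 'i%C * beta^*%C) ^+ 2)
              + Num.sqrt (1 - (1 - r - complex.Re (beta * (1 + 'i%C))) ^+ 2)).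
Proof.
apply: D_cut (mem_head _ _) _ => y b c r y0.
rewrite (propext (D_I33_pt r y0 erefl)) (propext (D_I21_pt r y0 erefl)).
rewrite (propext (arc_eq _ _ _ y0)) /=.
rewrite (_ : 1 - r - (b * (1 + 0) - c * (0 + 1)) = 1 - r - b + c); last by ring.
split=> [[m [e f]]|[[m e] f]]; split=> //; last split=> //; lra.
Qed.

Lemma sqrt3_sqr : Num.sqrt 3 * Num.sqrt 3 = 3 :> R.
Proof. by rewrite -expr2 sqr_sqrtr. Qed.

Lemma tau_half y b c r (t := (b ^+ 2 + c ^+ 2) / 2 + y ^+ 2) : 0 < y ->
  r ^+ 2 + t ^+ 2 = 1 -> r = 1 / 2 -> t = Num.sqrt 3 / 2.
Proof.
move=> /(tau_gt0 b c); rewrite -/t => t0 e rE; rewrite rE in e.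
have w := sqrt3_sqr; have w0 : 0 <= Num.sqrt 3 :> R by rewrite sqrtr_ge0.
have : (t - Num.sqrt 3 / 2) * (t + Num.sqrt 3 / 2) = 0 by lra.
by move=> /eqP; rewrite mulf_eq0 => /orP[] /eqP h; lra.
Qed.

Lemma D_I41_eq : D (I41 R) = D (I21 R) `&` locus (fun y beta r =>
     r = 1 / 2 /\
     normc (beta - ((1 + Num.sqrt 3) / 4)%:C%C
                   * (1 + (Num.sqrt 3)%:C%C * 'i%C)) ^+ 2
       = 1 / 2).
Proof.
apply: D_cut (mem_head _ _) _ => y b c r y0.
rewrite (propext (D_I41_pt r y0 erefl)) (propext (D_I21_pt r y0 erefl)).
rewrite sqr_normc /=.
have th := @tau_half y b c r y0; move: th; set t := (_ + y ^+ 2) => th.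
have w := sqrt3_sqr; set w3 := Num.sqrt 3 in th w *.
have -> : b - ((1 + w3) / 4 * (1 + (w3 * 0 - 0 * 1))
               - 0 * (0 + (w3 * 1 + 0 * 0)))
  = b - (1 + w3) / 4 by ring.
have -> : c - ((1 + w3) / 4 * (0 + (w3 * 1 + 0 * 0))
               + 0 * (1 + (w3 * 0 - 0 * 1)))
  = c - (w3 + 3) / 4 by rewrite -w; field.
(* Once r = 1/2 and t = sqrt 3 / 2 are fixed, the remaining equation is that of a circle in the beta
   plane. *)
suff iff : r ^+ 2 + t ^+ 2 = 1 -> r = 1 / 2 ->
   (b - c + r) ^+ 2 + (1 + t - b - c) ^+ 2 = 1 <->
   (b - (1 + w3) / 4) ^+ 2 + (c - (w3 + 3) / 4) ^+ 2 = 1 / 2 by tauto.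
by move=> e f; rewrite (th e f) f; split=> h; lra.
Qed.

Lemma D_I42_eq : D (I42 R) = D (I21 R) `&` locus (fun y beta r =>
     r = 0 /\ normc (beta - (3 + 'i%C) / 2) ^+ 2 = 1 / 2).
Proof.
apply: D_cut (mem_head _ _) _ => y b c r y0.
rewrite (propext (D_I42_pt r y0 erefl)) (propext (D_I21_pt r y0 erefl)).
have -> : (3 + 'i%C) / 2 = (3 / 2 +i* (1 / 2))%C :> R[i].
  apply: (@mulIf _ 2); first by rewrite pnatr_eq0.
  by rewrite divfK ?pnatr_eq0 //; apply: eq_complexP => /=; field.
rewrite sqr_normc /=; have t0 := tau_gt0 b c y0.
have y2 : 0 < y ^+ 2 by rewrite exprn_gt0.
set t := (_ + y ^+ 2) in t0 *.
have Kt : b ^+ 2 + c ^+ 2 < 2 * t by rewrite /t; lra.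
clearbody t; split=> [[m [e [f g]]]|[[m e] [rE h]]]; last first.
  (* At r = 0 and t = 1 the two remaining equations describe the same circle. *)
  rewrite rE in m e *; have tE : t = 1 by nra.
  by rewrite tE; split=> //; split; [|split]; lra.
suff rE : r = 0.
  rewrite rE in m e f g *; have tE : t = 1 by nra.
  by rewrite tE in g; split=> //; split=> //; lra.
(* Subtracting twice [g] from [f] eliminates |beta|^2. *)
have line : b * (r - (1 - t)) + c * (r + (1 - t)) = 2 * r by lra.
apply/eqP/negP => /negP r0.
have r2 : 0 < r ^+ 2 by rewrite lt_def sqrf_eq0 r0 sqr_ge0.
(* Cauchy-Schwarz applied to [line] *)
have cs : 4 * r ^+ 2 <= (b ^+ 2 + c ^+ 2) * (2 * (r ^+ 2 + (1 - t) ^+ 2)).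
  have sq : 0 <= (b * (r + (1 - t)) - c * (r - (1 - t))) ^+ 2.
    by rewrite sqr_ge0.
  have -> : 4 * r ^+ 2 = (b * (r - (1 - t)) + c * (r + (1 - t))) ^+ 2.
    by rewrite line; ring.
  lra.
have t1 : t < 1 by nra.
(* In [cs], r^2 + (1 - t)^2 = 2 (1 - t) and r^2 = (1 - t) (1 + t), so 4 (1 - t) cancels. With [Kt]
   this gives 1 + t < 2 t, against t < 1. *)
have k1 : 1 + t <= b ^+ 2 + c ^+ 2.
  have p : 0 < 4 * (1 - t) by lra.
  by rewrite -(ler_pM2l p); nra.
lra.
Qed.
End Parts2.

(** * The two families whose contact set is a single point *)

Section Parts3.
Variable R : realType.
Implicit Types (y b c r t : R) (beta : R[i]).

Lemma pos_sqr_inj (a b : R) : 0 < a -> 0 < b -> a ^+ 2 = b ^+ 2 -> a = b.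
Proof.
by move=> a0 b0 /eqP; rewrite eqrXn2 ?ltW // => /eqP.
Qed.

Lemma D_point (J : seq 'cV[R[i]]_3) (y1 b1 c1 r1 : R) :
  vec3 1 0 0 \in J -> 0 < y1 ->
  (forall y b c r, 0 < y -> D (assoc_parab J) (pt y (b +i* c)%C r) <->
     [/\ y = y1, b = b1, c = c1 & r = r1]) ->
  D (assoc_parab J) = [set pt y1 (b1 +i* c1)%C r1].
Proof.
move=> J1 y10 h; apply: eq_symspace; first exact: D_symspace.
  by move=> _ ->; exact: symspace_pt.
move=> y [b c] r y0; rewrite (propext (h y b c r y0)).
by split=> [[-> -> -> ->]//|/pt_inj[]// -> [-> ->] ->].
Qed.

Lemma height_ge y beta r w : 0 < y -> isotropic w ->
  y ^+ 4 * normc (w 2 0) ^+ 2 <= height w y beta r.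
Proof.
move=> y0 iw; rewrite -exhaust_vec_denom //.
have y2 : 0 < y ^+ 2 by rewrite exprn_gt0.
by rewrite lerDr addr_ge0 ?sqr_ge0 // mulr_ge0 ?sqr_ge0 ?ltW.
Qed.

Lemma minimal_i y : y ^+ 2 = 1 / 2 -> 0 < y -> minimal y (0 +i* 1)%C 0.
Proof.
move=> y2 y0 w iw rw; have := height_gt0 (0 +i* 1)%C 0 y0 iw (reduced_neq0 rw).
rewrite /height; set L := linform _ _ _ _ => L0.
apply: gaussian_normc_ge1; last first.
  apply: contraTneq L0 => ->.
  by rewrite ComplexField.Normc.normc0 expr0n ltxx.
case: rw => gw _.
have g (m k : R) : m \is a Num.int -> k \is a Num.int -> gaussian (m +i* k)%C.
  by [].
(* Here |beta|^2 / 2 + y^2 = 1, so the coefficients of the form are Gaussian integers. *)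
have LE : L = w 0 0 + (0 +i* (-1))%C * w 1 0 + (0 +i* 1)%C * w 2 0.
  rewrite /L /linform sqr_normc y2 /=.
  case: (w 0 0) (w 1 0) (w 2 0) => [a1 a2] [a3 a4] [a5 a6].
  by apply: eq_complexP => /=; field.
rewrite LE; apply: gaussianD; first apply: gaussianD => //.
  by apply: gaussianM => //; apply: g; rewrite ?rpredN ?rpred0 ?rpred1.
by apply: gaussianM => //; apply: g; rewrite ?rpredN ?rpred0 ?rpred1.
Qed.

Lemma D_I8_eq : D (I8 R) = [set pt (1 / Num.sqrt 2) 'i%C 0].
Proof.
have s2 : 0 < Num.sqrt 2 :> R by rewrite sqrtr_gt0.
have e2 : (1 / Num.sqrt 2) ^+ 2 = 1 / 2 :> R.
  by rewrite expr_div_n sqr_sqrtr // expr1n.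
have p2 : 0 < 1 / Num.sqrt 2 :> R by rewrite divr_gt0.
apply: (D_point (mem_head _ _) p2) => y b c r y0.
rewrite (propext (D_I8_pt r y0 erefl)); split.
  have t0 := tau_gt0 b c y0; have y2 : 0 < y ^+ 2 by rewrite exprn_gt0.
  set t := (_ + y ^+ 2) in t0 *.
  have tE : t = (b ^+ 2 + c ^+ 2) / 2 + y ^+ 2 by [].
  clearbody t => -[_ [h1 [h2 [h3 [h4 [h5 [h6 h7]]]]]]].
  (* [h2] and [h5] differ only in the sign of b + r. *)
  have rb : r = - b by lra.
  have : (c - t) * (c - t - 1) = 0 by rewrite rb in h2; lra.
  move=> /eqP; rewrite mulf_eq0 => /orP[] /eqP ct; last first.
    have b2 : 0 <= b ^+ 2 by rewrite sqr_ge0.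
    (* This root is impossible: c^2 / 2 = (t + 1)^2 / 2 already exceeds t. *)
    have cE : c = t + 1 by lra.
    by rewrite cE in tE; nra.
  have cE : c = t by lra.
  rewrite cE rb in tE h1 h3 h6 *.
  (* [h1] and [h6] force t = 1, and then b = 0. *)
  have bE : b = 0 by nra.
  have t1 : t = 1 by rewrite bE in h1; nra.
  rewrite bE t1 in tE *.
  split=> //; last by rewrite oppr0.
  by apply: (pos_sqr_inj y0 p2); rewrite e2; lra.
move=> [-> -> -> ->]; rewrite e2; split; first exact: minimal_i.
by do !split; lra.
Qed.

Lemma int_sqr_sum0 (e f : int) : e ^+ 2 + f ^+ 2 = 0 -> e = 0 /\ f = 0.
Proof.
move=> /eqP; rewrite paddr_eq0 ?sqr_ge0 // !sqrf_eq0.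
by move=> /andP[/eqP -> /eqP ->].
Qed.

(** This is the part free of sqrt 3 in |m + q omega|^2, with omega = (-1 + i sqrt 3) / 2. Twice it
    is |m - q|^2 + |m|^2 + |q|^2. *)
Lemma eisenstein_definite (m1 m2 q1 q2 : int) :
  m1 ^+ 2 + m2 ^+ 2 + q1 ^+ 2 + q2 ^+ 2 - (m1 * q1 + m2 * q2) < 1 ->
  [/\ m1 = 0, m2 = 0, q1 = 0 & q2 = 0].
Proof.
move=> I0; have : (m1 - q1) ^+ 2 + (m2 - q2) ^+ 2 + (m1 ^+ 2 + m2 ^+ 2)
    + (q1 ^+ 2 + q2 ^+ 2) <= 0 by lia.
have ge0 (a b : int) : 0 <= a ^+ 2 + b ^+ 2 by rewrite addr_ge0 ?sqr_ge0.
have := ge0 (m1 - q1) (m2 - q2); have := ge0 m1 m2; have := ge0 q1 q2.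
move=> k1 k2 k3 le0.
have [-> ->] : m1 = 0 /\ m2 = 0 by apply: int_sqr_sum0; lia.
by have [-> ->] : q1 = 0 /\ q2 = 0 by apply: int_sqr_sum0; lia.
Qed.

(** The equation is the isotropy relation after completing squares in e and f; its left side is
    nonnegative and B <= -1. *)
Lemma negative_pairing_bound (e f B q1 q2 : int) : B < 0 ->
  (2 * e + q2) ^+ 2 + (2 * f - q1) ^+ 2 = 4 * B + (q1 ^+ 2 + q2 ^+ 2) ->
  4 <= q1 ^+ 2 + q2 ^+ 2.
Proof.
move=> B0; have := sqr_ge0 (2 * e + q2); have := sqr_ge0 (2 * f - q1).
move: (_ ^+ 2) ((2 * e + q2) ^+ 2) (_ + q2 ^+ 2) => x1 x2 x3; lia.
Qed.

Lemma minimal_omega y : 0 < y -> y ^+ 2 = Num.sqrt 3 / 2 - 1 / 4 ->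
  minimal y (1 / 2 +i* (1 / 2))%C (1 / 2).
Proof.
move=> y0 y2 v iv rv; have v0 := reduced_neq0 rv.
have hge := height_ge (1 / 2 +i* (1 / 2))%C (1 / 2) y0 iv.
have w := @sqrt3_sqr R; have w0 : 0 <= Num.sqrt 3 :> R by rewrite sqrtr_ge0.
have w1 : 3 / 2 <= Num.sqrt 3 :> R by nra.
case: rv => gv _; have iv' := iv; move/isotropicE: iv'; move: hge.
rewrite heightE y2 !sqr_normc.
have [] := gv 0; have [] := gv 1; have [] := gv 2.
case E0 : (v 0 0) => [x1 x2]; case E1 : (v 1 0) => [x3 x4].
case E2 : (v 2 0) => [x5 x6] /=.
move=> /intrP[q1 e5] /intrP[q2 e6] /intrP[p1 e3] /intrP[p2 e4].
move=> /intrP[n1 e1] /intrP[n2 e2].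
subst x1 x2 x3 x4 x5 x6 => hge iso.
have isoz : p1 ^+ 2 + p2 ^+ 2 = 2 * (n2 * q1 - n1 * q2).
  apply: (@intr_inj R); rewrite !(rmorphD, rmorphM, rmorphXn, rmorphN) /=.
  by move: iso => /=; lra.
(* As |p|^2 is even, p = (1 + i) (f - i e), and then
   L_v = m + q (-1 + i sqrt 3) / 2 with m = n - (e + i f). *)
have [e [f [p1E p2E]]] : exists e f : int, p1 = e + f /\ p2 = f - e.
  have dE := divz_eq (p1 + p2) 2; have d0 := @modz_ge0 (p1 + p2) 2 erefl.
  have d1 := @ltz_pmod (p1 + p2) 2 erefl.
  move: (divz _ _) (modz _ _) dE d0 d1 => f d dE d0 d1.
  have [dz|dz] : d = 0 \/ d = 1 by lia.
    by exists (p1 - f), f; lia.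
  have : 2 * (2 * (f ^+ 2 + f)) + 1 = 2 * (n2 * q1 - n1 * q2 + p1 * p2).
    have <- : (p1 + p2) ^+ 2 = 2 * (n2 * q1 - n1 * q2 + p1 * p2).
      by rewrite mulrDr -isoz; ring.
    by rewrite dE dz; ring.
  lia.
pose m1 := n1 - e; pose m2 := n2 - f; pose B := m2 * q1 - m1 * q2.
have n1E : n1 = m1 + e by rewrite /m1; ring.
have n2E : n2 = m2 + f by rewrite /m2; ring.
have BE : B = m2 * q1 - m1 * q2 by [].
clearbody m1 m2 B; subst n1 n2 p1 p2.
have [B0|B0] := leP 0 B.
  set h := (X in _ <= X); have hE : h = (m1 ^+ 2 + m2 ^+ 2 + q1 ^+ 2 + q2 ^+ 2
     - (m1 * q1 + m2 * q2))%:~R + Num.sqrt 3 * B%:~R.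
    rewrite /h BE !(rmorphD, rmorphM, rmorphXn, rmorphN) /=.
    move: w; set s := Num.sqrt 3 => w.
    move: m1%:~R m2%:~R q1%:~R q2%:~R e%:~R f%:~R => x1 x2 x3 x4 x5 x6.
    have W (x : R) : s ^+ 2 * x = 3 * x by rewrite expr2 w.
    have := W (x3 ^+ 2); have := W (x4 ^+ 2); lra.
  rewrite hE; have I1 : 1 <= m1 ^+ 2 + m2 ^+ 2 + q1 ^+ 2 + q2 ^+ 2
     - (m1 * q1 + m2 * q2).
    rewrite leNgt; apply/negP => /eisenstein_definite[m10 m20 q10 q20].
    (* Isotropy with q = 0 forces p = 0, so v would vanish. *)
    have [e0 f0] : e = 0 /\ f = 0.
      apply: int_sqr_sum0; apply: (@mulfI _ 2) => //; rewrite mulr0.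
      transitivity (2 * ((m2 + f) * q1 - (m1 + e) * q2)).
        by rewrite -isoz; ring.
      by rewrite q10 q20; ring.
    move/eqP: v0; apply; apply: cV3_eq; rewrite mxE ?E0 ?E1 ?E2.
    - by rewrite m10 m20 e0 f0.
    - by rewrite e0 f0.
    - by rewrite q10 q20.
  have I1R : 1 <= (m1 ^+ 2 + m2 ^+ 2 + q1 ^+ 2 + q2 ^+ 2
     - (m1 * q1 + m2 * q2))%:~R :> R by rewrite ler1z.
  have BR : 0 <= Num.sqrt 3 * B%:~R :> R by rewrite mulr_ge0 ?ler0z.
  by apply: (le_trans I1R); rewrite lerDl.
have qz : 4 <= q1 ^+ 2 + q2 ^+ 2.
  apply: (@negative_pairing_bound e f B) => //; apply: (@mulfI _ 2) => //.
  have isoz' : 2 * (e ^+ 2 + f ^+ 2) = 2 * ((m2 + f) * q1 - (m1 + e) * q2).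
    by rewrite -isoz; ring.
  rewrite BE; transitivity (4 * (2 * (e ^+ 2 + f ^+ 2))
    + 2 * (4 * e * q2 - 4 * f * q1 + q1 ^+ 2 + q2 ^+ 2)); first by ring.
  by rewrite isoz'; ring.
have qR : 4 <= q1%:~R ^+ 2 + q2%:~R ^+ 2 :> R.
  by rewrite -!rmorphXn -rmorphD /= (ler_int _ 4).
apply: le_trans hge; have -> : y ^+ 4 = (y ^+ 2) ^+ 2 by ring.
(* From sqrt 3 >= 3/2 one gets y^2 >= 1/2. *)
have yh : 1 / 4 <= (y ^+ 2) ^+ 2 by rewrite y2; nra.
move: (q1%:~R ^+ 2 + _) qR => Q qR; move: ((y ^+ 2) ^+ 2) yh => Y yh.
by clear -Q qR Y yh; nra.
Qed.

Lemma D_I5_eq : D (I5 R) = [set pt (Num.sqrt (-1 + 2 * Num.sqrt 3) / 2)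
                      ((1 + 'i%C) / 2) (1 / 2)].
Proof.
have w := @sqrt3_sqr R; have w0 : 0 <= Num.sqrt 3 :> R by rewrite sqrtr_ge0.
have w1 : 3 / 2 <= Num.sqrt 3 :> R by nra.
have -> : (1 + 'i%C) / 2 = (1 / 2 +i* (1 / 2))%C :> R[i].
  apply: (@mulIf _ 2); first by rewrite pnatr_eq0.
  by rewrite divfK ?pnatr_eq0 //; apply: eq_complexP => /=; field.
set y1 := Num.sqrt (-1 + 2 * Num.sqrt 3) / 2.
have y10 : 0 < y1 by rewrite divr_gt0 // sqrtr_gt0; lra.
have y1E : y1 ^+ 2 = Num.sqrt 3 / 2 - 1 / 4.
  by rewrite /y1 expr_div_n sqr_sqrtr; [field | lra].
apply: (D_point (mem_head _ _) y10) => y b c r y0.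
rewrite (propext (D_I5_pt r y0 erefl)); split; last first.
  move=> [-> -> -> ->]; rewrite y1E; split; first exact: minimal_omega.
  by do !split; lra.
move=> [_ [h1 [rE [h2 h3]]]]; have tE := tau_half y0 h1 rE.
have y2 : 0 < y ^+ 2 by rewrite exprn_gt0.
move: h1 h2 h3; rewrite tE rE => h1 h2 h3.
(* [h2] and [h3] differ only in the sign of b - c. *)
have bc : c = b by nra.
have : (2 * b - 1) * (2 * b - 1 - Num.sqrt 3) = 0 by rewrite bc in h2; lra.
move=> /eqP; rewrite mulf_eq0 => /orP[] /eqP hb; last first.
  (* For this root |beta|^2 / 2 = 1 + sqrt 3 / 2, which exceeds t. *)
  have bE : b = (1 + Num.sqrt 3) / 2 by lra.
  by rewrite bc bE in tE; nra.
have bE : b = 1 / 2 by lra.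
split=> //; last by rewrite bc.
apply: (pos_sqr_inj y0 y10); rewrite y1E.
by rewrite bc bE in tE; lra.
Qed.
End Parts3.

Theorem theorem7p1 (R : realType) :
  (* (i) *)
  (E (I21 R) = locus (fun y beta r =>
     y ^+ 2 = - (normc beta ^+ 2 / 2) + Num.sqrt (1 - r ^+ 2))) /\
  (* (ii) *)
  (E (I22 R) = locus (fun y beta r =>
     y ^+ 2 = - (1 / 2 * normc (1 - 'i%C * beta^*%C) ^+ 2)
              + Num.sqrt (1 / 2 - (1 / 2 - complex.Re beta - r) ^+ 2))) /\
  (* (iii) *)
  (D (I21 R) `<=` E (I21 R) `&` locus (fun y beta r =>
     [/\ 1 / Num.sqrt 5 < y ^+ 2 <= 1,
         - (1 / 2) <= r <= 1 / 2 &
         normc beta ^+ 2 < - (2 / Num.sqrt 5) + 2])) /\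
  (* (iv) *)
  (D (I22 R) `<=` E (I22 R) `&` locus (fun y beta r =>
     0 <= complex.Re beta + r < Num.sqrt (3 / 10) + 1 / 2)) /\
  (* (v) *)
  (D (I31 R) = D (I21 R) `&` locus (fun y beta r => r = 1 / 2)) /\
  (* (vi) *)
  (D (I32 R) = D (I21 R) `&` locus (fun y beta r =>
     y ^+ 2 = - (1 / 2 * normc (1 + 'i%C - 'i%C * beta^*%C) ^+ 2)
              + Num.sqrt (1 - (complex.Re (beta * (1 + 'i%C)) + r) ^+ 2))) /\
  (* (vii) *)
  (D (I33 R) = D (I21 R) `&` locus (fun y beta r =>
     y ^+ 2 = - (1 / 2 * normc (1 + 'i%C - 'i%C * beta^*%C) ^+ 2)
              + Num.sqrt (1 - (1 - r - complex.Re (beta * (1 + 'i%C))) ^+ 2))) /\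
  (* (viii) *)
  (D (I41 R) = D (I21 R) `&` locus (fun y beta r =>
     r = 1 / 2 /\
     normc (beta - ((1 + Num.sqrt 3) / 4)%:C%C * (1 + (Num.sqrt 3)%:C%C * 'i%C)) ^+ 2
       = 1 / 2)) /\
  (* (ix) *)
  (D (I42 R) = D (I21 R) `&` locus (fun y beta r =>
     r = 0 /\ normc (beta - (3 + 'i%C) / 2) ^+ 2 = 1 / 2)) /\
  (* (x) *)
  (D (I5 R) = [set pt (Num.sqrt (-1 + 2 * Num.sqrt 3) / 2)
                      ((1 + 'i%C) / 2) (1 / 2)]) /\
  (* (xi) *)
  (D (I8 R) = [set pt (1 / Num.sqrt 2) 'i%C 0]).
Proof.
split; first exact: E_I21_eq.
split; first exact: E_I22_eq.
split; first exact: D_I21_sub.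
split; first exact: D_I22_sub.
split; first exact: D_I31_eq.
split; first exact: D_I32_eq.
split; first exact: D_I33_eq.
split; first exact: D_I41_eq.
split; first exact: D_I42_eq.
by split; [exact: D_I5_eq | exact: D_I8_eq].
Qed.
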